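(* Let $(X,d,\mathfrak m)$ be an essentially non-branching (geodesic) metric measure space and $G$ a compact Lie group acting on $X$ by measure-preserving isometries such that the orbit space $X^\ast=X/G$ is isometric to $[-1,1]$, $[0,\infty)$, $\mathbb R$, or $\mathbf S^1$. Then for any $x_0\in X$ there exists $\delta_0>0$ such that, for any $0<\delta<\delta_0$, the set $$S_{x_0}:=\{y\in X \mid d(x_0,y)=d(G(x_0),y)\}\cap B_\delta(x_0)$$ is a slice through $x_0$.
   Context: A metric measure space is a complete separable metric space with a non-negative Borel measure finite on balls; $(X,d)$ is geodesic if any two points are joined by a curve $\gamma:[0,1]\to X$ with $d(\gamma_t,\gamma_s)=|t-s|d(\gamma_0,\gamma_1)$; $\mathrm{Geo}(X)$ is the space of such curves with the sup distance. Essentially non-branching: let $\mathbb P_2(X)$ be the Borel probability measures with finite second moment, and for $\mu_0,\mu_1\in\mathbb P_2(X)$ let $\mathrm{OptGeo}(\mu_0,\mu_1)$ be the set of probability measures $\eta$ on $\mathrm{Geo}(X)$ such that $(e_0,e_1)_\#\eta$ is an optimal coupling of $\mu_0,\mu_1$ for the cost $d^2$, where $e_t(\gamma)=\gamma_t$. $(X,d,\mathfrak m)$ is essentially non-branching if for all $\mu_0,\mu_1\in\mathbb P_2(X)$ absolutely continuous with respect to $\mathfrak m$, every $\rho\in\mathrm{OptGeo}(\mu_0,\mu_1)$ is concentrated on a set of non-branching geodesics, i.e. a set $\Gamma$ such that two elements of $\Gamma$ coinciding on $[0,t]$ for some $t\in(0,1)$ are equal. The action is measure-preserving if $g_\#\mathfrak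 m=\mathfrak m$ for all $g\in G$. $G(x)$ is the orbit and $G_x$ the isotropy group of $x$; $X^\ast$ carries the metric $d^\ast(x^\ast,y^\ast)=d(G(x),G(y))$. $B_\delta(x_0)$ is the open ball. Slice: a set $S\ni x$ is a slice at $x$ if (i) $S$ is closed in $G(S)=\bigcup_{g\in G} gS$; (ii) $G(S)$ is an open neighbourhood of $G(x)$; (iii) $G_x(S)=S$; (iv) $(gS)\cap S\neq\emptyset$ implies $g\in G_x$.
   Formalization: The measure is assumed to have full support (every open ball has positive measure); without this the claim fails, e.g. for zero measure on the product of the circle and the line with the sup metric, the circle acting by rotation. *)

(* Defs.v *)
From HB Require Import structures.
From mathcomp Require Import all_boot all_order all_algebra.
From mathcomp Require Import all_classical all_reals all_analysis.

Set Implicit Arguments.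
Unset Strict Implicit.
Unset Printing Implicit Defensive.

Import Order.TTheory GRing.Theory Num.Theory.
Import numFieldNormedType.Exports.

Local Open Scope classical_set_scope.
Local Open Scope ring_scope.

(* The base point carried by [Complete] only records that the space is
   nonempty; it plays no role in the mathematics. *)
#[short(type="completeMetricType")]
HB.structure Definition CompleteMetric (K : numDomainType) :=
  {T of Complete T & Metric K T}.

Definition separable (T : topologicalType) : Prop :=
  exists2 D : set T, countable D & dense D.

Notation borel T := (g_sigma_algebraType (@open T)).

Section MetricGeometry.
Context {R : realType}.

Definition unit_itv : Type := {t : R | 0 <= t <= 1}.

Lemma unit_itv0_subproof : (0 : R) <= (0 : R) <= (1 : R).
Proof. by rewrite lexx ler01. Qed.
Lemma unit_itv1_subproof : (0 : R) <= (1 : R) <= (1 : R).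
Proof. by rewrite lexx ler01. Qed.

Definition itv0 : unit_itv := exist _ 0 unit_itv0_subproof.
Definition itv1 : unit_itv := exist _ 1 unit_itv1_subproof.

Record geodesic (X : completeMetricType R) := Geodesic {
  curve :> unit_itv -> X ;
  curveP : forall s t : unit_itv,
    mdist (curve t) (curve s) =
    `|val t - val s| * mdist (curve itv0) (curve itv1) }.

Definition geodesic_space (X : completeMetricType R) : Prop :=
  forall x y : X, exists c : geodesic X, c itv0 = x /\ c itv1 = y.

Definition sup_dist (X : completeMetricType R) (c c' : geodesic X) : R :=
  sup (range (fun t => mdist (c t) (c' t))).

Section GeodesicMetric.
Variable X : completeMetricType R.
Implicit Types c : geodesic X.

Lemma geodesic_ext c c' : (forall t, c t = c' t) -> c = c'.
Proof.
case: c => f Hf; case: c' => g Hg /= fg.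
have E : f = g by apply/funext.
by subst g; congr Geodesic; exact: Prop_irrelevance.
Qed.

Lemma geodesic_bnd c t : mdist (c t) (c itv0) <= mdist (c itv0) (c itv1).
Proof.
rewrite curveP /= subr0 ler_piMl// ?mdist_ge0//.
by case: t => t /= /andP[t0 t1]; rewrite ger0_norm.
Qed.

Lemma sup_dist_has_sup c c' : has_sup (range (fun t => mdist (c t) (c' t))).
Proof.
split; first by exists (mdist (c itv0) (c' itv0)); exists itv0.
exists (mdist (c itv0) (c itv1) +
  (mdist (c itv0) (c' itv0) + mdist (c' itv0) (c' itv1))) => _ [t _ <-].
apply: le_trans (metric_triangle _ (c itv0) _) _.
apply: lerD; first exact: geodesic_bnd.
apply: le_trans (metric_triangle _ (c' itv0) _) _.
by rewrite lerD2l metric_sym geodesic_bnd.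
Qed.

Lemma le_sup_dist c c' t : mdist (c t) (c' t) <= sup_dist c c'.
Proof. by apply: sup_upper_bound; [exact: sup_dist_has_sup | exists t]. Qed.

Lemma sup_dist_le c c' r : (forall t, mdist (c t) (c' t) <= r) ->
  sup_dist c c' <= r.
Proof.
move=> H; apply: ge_sup; first by case: (sup_dist_has_sup c c').
by move=> _ [t _ <-].
Qed.

Lemma sup_distxx c : sup_dist c c = 0.
Proof.
apply/eqP; rewrite eq_le; apply/andP; split.
  by apply: sup_dist_le => t; rewrite mdistxx.
by apply: le_trans (le_sup_dist c c itv0); rewrite mdistxx.
Qed.

Lemma sup_dist_positivity c c' : sup_dist c c' = 0 -> c = c'.
Proof.
move=> H; apply: geodesic_ext => t; apply: mdist_positivity; apply/eqP.
by rewrite eq_le mdist_ge0 andbT -H le_sup_dist.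
Qed.

Lemma sup_dist_sym c c' : sup_dist c c' = sup_dist c' c.
Proof.
rewrite /sup_dist; under eq_fun do rewrite metric_sym.
by [].
Qed.

Lemma sup_dist_triangle c2 c1 c3 :
  sup_dist c1 c3 <= sup_dist c1 c2 + sup_dist c2 c3.
Proof.
apply: sup_dist_le => t; apply: le_trans (metric_triangle _ (c2 t) _) _.
by apply: lerD; exact: le_sup_dist.
Qed.

Lemma cst_geodesic_subproof (x : X) (s t : unit_itv) :
  mdist x x = `|val t - val s| * mdist x x.
Proof. by rewrite mdistxx mulr0. Qed.

HB.instance Definition _ := gen_eqMixin (geodesic X).
HB.instance Definition _ := gen_choiceMixin (geodesic X).
HB.instance Definition _ := isPointed.Build (geodesic X)
  (@Geodesic X (fun=> point) (cst_geodesic_subproof point)).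
HB.instance Definition _ := @isMetric.Build R (geodesic X) (@sup_dist X)
  sup_distxx sup_dist_positivity sup_dist_sym sup_dist_triangle.

End GeodesicMetric.

Section OptimalTransport.
Variable X : completeMetricType R.
Local Open Scope ereal_scope.

Definition finite_second_moment (mu : probability (borel X) R) : Prop :=
  exists x0 : X, \int[mu]_x ((mdist x0 (x : X)) ^+ 2)%:E < +oo.

Definition coupling (mu0 mu1 : probability (borel X) R)
    (pi : set (borel X * borel X) -> \bar R) : Prop :=
  forall A : set (borel X), measurable A ->
    pushforward pi fst A = mu0 A /\ pushforward pi snd A = mu1 A.

Definition cost (pi : set (borel X * borel X) -> \bar R) : \bar R :=
  \int[pi]_p ((mdist (p.1 : X) (p.2 : X)) ^+ 2)%:E.

Definition optimal_coupling (mu0 mu1 : probability (borel X) R)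
    (pi : set (borel X * borel X) -> \bar R) : Prop :=
  coupling mu0 mu1 pi /\
  forall pi' : probability (borel X * borel X)%type R,
    coupling mu0 mu1 pi' -> cost pi <= cost pi'.

Definition endpoints (c : borel (geodesic X)) : borel X * borel X :=
  ((c : geodesic X) itv0, (c : geodesic X) itv1).

Definition OptGeo (mu0 mu1 : probability (borel X) R) :
    set (probability (borel (geodesic X)) R) :=
  [set eta | optimal_coupling mu0 mu1 (pushforward eta endpoints)].

Definition non_branching (Gamma : set (geodesic X)) : Prop :=
  forall c c' : geodesic X, Gamma c -> Gamma c' ->
    (exists2 t : R, (0 < t < 1)%R &
      forall s : unit_itv, (val s <= t)%R -> c s = c' s) ->
    c = c'.

Definition essentially_non_branching (m : {measure set (borel X) -> \bar R}) :
    Prop :=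
  forall mu0 mu1 : probability (borel X) R,
    finite_second_moment mu0 -> finite_second_moment mu1 ->
    mu0 `<< m -> mu1 `<< m ->
    forall rho, OptGeo mu0 mu1 rho ->
      exists2 Gamma : set (borel (geodesic X)),
        non_branching Gamma & rho.-negligible (~` Gamma).

Definition finite_on_balls (m : {measure set (borel X) -> \bar R}) : Prop :=
  forall (x : X) (r : R), m (ball x r) < +oo.

(* supp m = X. *)
Definition full_support (m : {measure set (borel X) -> \bar R}) : Prop :=
  forall (x : X) (r : R), (0 < r)%R -> 0 < m (ball x r).

End OptimalTransport.
End MetricGeometry.
Arguments unit_itv R : clear implicits.

HB.mixin Record isTopologicalGroup G of Group G & Topological G := {
  mulg_continuous : continuous (fun p : G * G => (p.1 * p.2)%g) ;
  invg_continuous : continuous (fun g : G => (g^-1)%g) }.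

#[short(type="topologicalGroupType")]
HB.structure Definition TopologicalGroup :=
  {G of isTopologicalGroup G & Group G & Topological G}.

Section LieGroup.
Context {R : realType}.

(* C^k on an open set U: all iterated partial derivatives of order at most k
   exist and are continuous at every point of U. *)
Fixpoint Ck_on (k n : nat) (U : set 'rV[R]_n) (f : 'rV[R]_n -> R) : Prop :=
  (forall x, U x -> {for x, continuous f}) /\
  if k is k'.+1 then
    forall i : 'I_n,
      (forall x, U x -> derivable f x (delta_mx 0 i)) /\
      Ck_on k' U (fun x => 'D_(delta_mx 0 i) f x)
  else True.

Definition smooth_on (n p : nat) (U : set 'rV[R]_n)
    (f : 'rV[R]_n -> 'rV[R]_p) : Prop :=
  forall (k : nat) (j : 'I_p), Ck_on k U (fun x => f x 0 j).

Record chart (G : topologicalType) (n : nat) := Chart {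
  chart_dom : set G ;
  chart_map :> G -> 'rV[R]_n ;
  chart_inv : 'rV[R]_n -> G }.

Definition chart_cod (G : topologicalType) n (c : chart G n) : set 'rV[R]_n :=
  c @` chart_dom c.

Definition is_chart (G : topologicalType) n (c : chart G n) : Prop :=
  [/\ open (chart_dom c), open (chart_cod c),
      forall g, chart_dom c g -> chart_inv c (c g) = g,
      forall g, chart_dom c g -> {for g, continuous c} &
      forall v, chart_cod c v -> {for v, continuous (chart_inv c)}].

Definition smooth_atlas (G : topologicalType) n (A : set (chart G n)) : Prop :=
  [/\ forall c, A c -> is_chart c,
      forall g, exists2 c, A c & chart_dom c g &
      forall c c', A c -> A c' ->
        smooth_on (c @` (chart_dom c `&` chart_dom c')) (c' \o chart_inv c)].

(* An n-dimensional real Lie group: a second countable Hausdorff smooth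
   n-manifold whose multiplication and inversion are smooth in charts; a chart
   of G * G is a pair of charts, with values in 'rV_(n + n).  The case n = 0
   is allowed, so finite groups are compact Lie groups. *)
Definition lie_group (G : topologicalGroupType) : Prop :=
  hausdorff_space G /\ @second_countable G /\
  exists (n : nat) (A : set (chart G n)),
    [/\ smooth_atlas A,
        forall c1 c2 c3, A c1 -> A c2 -> A c3 ->
          let mul (v : 'rV[R]_(n + n)) : G :=
            (chart_inv c1 (lsubmx v) * chart_inv c2 (rsubmx v))%g in
          smooth_on [set v | [/\ chart_cod c1 (lsubmx v),
                                 chart_cod c2 (rsubmx v) &
                                 chart_dom c3 (mul v)]]
                    (fun v => c3 (mul v)) &
        forall c c', A c -> A c' ->
          smooth_on (c @` [set g | chart_dom c g /\ chart_dom c' (g^-1)%g])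
                    (fun v => c' ((chart_inv c v)^-1)%g)].

Definition compact_lie_group (G : topologicalGroupType) : Prop :=
  lie_group G /\ compact [set: G].

End LieGroup.
Arguments lie_group R G : clear implicits.
Arguments compact_lie_group R G : clear implicits.

Section Actions.
Context {R : realType} {X : completeMetricType R} {G : topologicalGroupType}.
Variable act : G -> X -> X.

Definition continuous_action : Prop :=
  [/\ forall x, act 1%g x = x,
      forall g h x, act (g * h)%g x = act g (act h x) &
      continuous (fun p : G * X => act p.1 p.2)].

Definition isometric_action : Prop :=
  forall g x y, mdist (act g x) (act g y) = mdist x y.

Definition measure_preserving (m : {measure set (borel X) -> \bar R}) : Prop :=
  forall (g : G) (A : set (borel X)), measurable A ->
    pushforward m (act g : borel X -> borel X) A = m A.

Definition act_orbit (x : X) : set X := range (fun g => act g x).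

Definition isotropy (x : X) : set G := [set g | act g x = x].

Definition saturation (H : set G) (S : set X) : set X :=
  \bigcup_(g in H) act g @` S.

Definition orbit_space : set (set X) := range act_orbit.

Definition is_slice (x : X) (S : set X) : Prop :=
  S x /\
  [/\ exists2 C : set X, closed C & S = C `&` saturation setT S,
      open (saturation setT S) /\ act_orbit x `<=` saturation setT S,
      saturation (isotropy x) S = S &
      forall g : G, (act g @` S) `&` S !=set0 -> isotropy x g].

End Actions.

Section OrbitSpaceModels.
Context {R : realType}.

Definition set_dist {X : completeMetricType R} (A B : set X) : R :=
  inf [set r | exists x y, [/\ A x, B y & r = mdist x y]].

Definition isometric (T U : Type) (A : set T) (dA : T -> T -> R)
    (B : set U) (dB : U -> U -> R) : Prop :=
  exists2 f : T -> U, set_bij A B f &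
    forall x y, A x -> A y -> dB (f x) (f y) = dA x y.

Definition line_dist (s t : R) : R := `|s - t|.

Definition circle : set (R * R) := [set p | p.1 ^+ 2 + p.2 ^+ 2 = 1].

(* Arc length (angle) distance of the unit circle: the intrinsic metric, not
   the chordal one. *)
Definition arc_dist (p q : R * R) : R := acos (p.1 * q.1 + p.2 * q.2).

End OrbitSpaceModels.

(* Main.v *)
Require Import Defs.
From HB Require Import structures.
From mathcomp Require Import all_boot all_order all_algebra.
From mathcomp Require Import all_classical all_reals all_analysis.
From mathcomp Require Import measurable_realfun lra ring.

Set Implicit Arguments.
Unset Strict Implicit.
Unset Printing Implicit Defensive.

Import Order.TTheory GRing.Theory Num.Theory.
Import numFieldNormedType.Exports.

Local Open Scope classical_set_scope.
Local Open Scope ring_scope.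

(** For the set of points near x to which x is nearest on its orbit, all conditions
    on a slice but the last are formal, and the last one says that a point y close to
    the orbit of x has only one nearest point on it (slice_of_unique_foot).

    Let x and g x be distinct nearest points to y on the orbit of x. In each of the
    four models of the orbit space, the segment from the orbit of x to that of y goes
    on to the orbit of some z (locally_prolongable_models), and z can be taken
    nearest to y. Geodesics from x and from g x to y, each followed by one and the
    same geodesic from y to z, give two shortest paths between the orbits of x and z
    that agree beyond y. Let f be the distance to the orbit of x. An orbit between
    those of x and z is determined by the value of f on it, its level, so both paths
    meet all of them; together they form a compact invariant set K, and levels
    strictly between the extreme ones are in its interior.

    A single pair of branching geodesics is compatible with essential non-branching,
    so the pair is spread over sets of positive measure (two_feet_absurd). Take a
    random element h of the group, with a right-invariant law, and, independently,
    two comonotone random levels: s above the level of y and t close to 0, each with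
    the law of f under the restriction of m to a range of levels. Follow either of
    the two paths, with probability one half, from level s down to level t, and
    translate the segment by h. This defines a probability on geodesics, with the
    following properties.
    - Its endpoints have laws that are absolutely continuous with respect to m: as m
      is invariant, averaging over the group shows that an m-null set has probability
      zero at almost every level (null_levels, segment_law).
    - It is an optimal plan: f is 1-Lipschitz, so any coupling of the endpoints costs
      at least the mean square of the positive part of the loss of level. Among
      couplings with given laws of levels this is least for a comonotone one
      (comonotone_cost_le), and a segment loses as much level as its length.
    So the plan is concentrated on a set of non-branching geodesics. For almost all
    h, s and t this set contains both segments, one for each path. They agree
    until the level of y, hence are equal; but close to level 0 the two paths stay
    apart, since x and g x are distinct.

    The random group element only needs to be right-invariant and measurable enough
    for h to act measurably on K. Its law is built from covering numbers for the
    pseudometric on the group given by the uniform distance on K, which is invariant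
    under right translations (isometry_invariant_outer_measure, invariant_sampler). *)

(** * Covering numbers and limits along an ultrafilter *)

Section CoveringNumbers.

Context {R : realType} {T : choiceType}.
Variable D : T -> T -> R.
Implicit Types (A B : set T) (e : R).

Definition net_covers (A : set T) (e : R) (s : seq T) :=
  forall y, A y -> exists2 x, x \in s & D x y < e.

Hypothesis Dtb : forall e : R, 0 < e -> exists s, net_covers setT e s.

Definition covnum_spec (A : set T) (e : R) (n : nat) : Prop :=
  (exists2 s, size s = n & net_covers A e s) /\
  forall s, net_covers A e s -> (n <= size s)%N.

Lemma covnum_exists A e : exists n, 0 < e -> covnum_spec A e n.
Proof.
have [e0|ne0] := pselect (0 < e); last by exists 0%N => /ne0.
have [s cs] := Dtb e0.
have ex : exists n, `[< exists2 s, size s = n & net_covers A e s >].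
  exists (size s); apply/asboolP; exists s => [//|y _].
  by case: (cs y I) => x; exists x.
exists (ex_minn ex) => _; case: ex_minnP => n /asboolP[t tn ct] nmin.
split; first by exists t.
by move=> u cu; apply: nmin; apply/asboolP; exists u.
Qed.

Definition covnum A e : nat := projT1 (cid (covnum_exists A e)).

Lemma covnumP A e : 0 < e -> covnum_spec A e (covnum A e).
Proof. by rewrite /covnum; case: cid. Qed.

Lemma covnum0 e : 0 < e -> covnum set0 e = 0%N.
Proof.
move=> e0; have [_ /(_ [::])] := covnumP set0 e0.
by rewrite leqn0 => H; apply/eqP; apply: H.
Qed.

Lemma covnum_le A B e : 0 < e -> A `<=` B -> (covnum A e <= covnum B e)%N.
Proof.
move=> e0 AB; have [_ minA] := covnumP A e0.
by have [[s <- cs] _] := covnumP B e0; apply: minA => y /AB; exact: cs.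
Qed.

Lemma covnumU_le A B e : 0 < e ->
  (covnum (A `|` B) e <= covnum A e + covnum B e)%N.
Proof.
move=> e0; have [_ minU] := covnumP (A `|` B) e0.
have [[s <- cs] _] := covnumP A e0; have [[t <- ct] _] := covnumP B e0.
rewrite -size_cat; apply: minU => y [/cs|/ct] [x xs xy]; exists x => //;
  by rewrite mem_cat xs ?orbT.
Qed.

Lemma covnum_gt0 A e : 0 < e -> A !=set0 -> (0 < covnum A e)%N.
Proof.
move=> e0 [y Ay]; have [[s <- cs] _] := covnumP A e0.
by have [x] := cs _ Ay; case: s {cs}.
Qed.

Hypothesis Dsym : forall x y, D x y = D y x.
Hypothesis Dtri : forall y x z, D x z <= D x y + D y z.

(** A ball meeting both sets would produce two points, one in each, at distance
    less than twice its radius; so an optimal cover splits in two. *)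
Lemma covnumU_ge A B e : 0 < e -> (forall x y, A x -> B y -> 2 * e <= D x y) ->
  (covnum A e + covnum B e <= covnum (A `|` B) e)%N.
Proof.
move=> e0 sep; have [[s <- cs] _] := covnumP (A `|` B) e0.
have [_ minA] := covnumP A e0; have [_ minB] := covnumP B e0.
pose p (C : set T) x := `[< exists2 y, C y & D x y < e >].
have covp C : C `<=` A `|` B -> net_covers C e [seq x <- s | p C x].
  move=> sub y Cy; have [x xs xy] := cs y (sub _ Cy); exists x => //.
  by rewrite mem_filter xs andbT; apply/asboolP; exists y.
have disj x : ~~ (p A x && p B x).
  apply/negP => /andP[/asboolP[y Ay xy] /asboolP[z Bz xz]].
  have := sep _ _ Ay Bz; have := Dtri x y z; rewrite (Dsym y x); lra.
apply: (@leq_trans (size [seq x <- s | p A x] + size [seq x <- s | p B x])%N).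
  by apply: leq_add; [apply/minA/covp|apply/minB/covp] => y; [left|right].
rewrite !size_filter -(count_predUI (p A) (p B)).
rewrite [X in (_ + X)%N](_ : _ = 0%N) ?addn0 ?count_size//.
by apply/eqP; rewrite -leqn0 leqNgt -has_count; apply/hasPn => x _; exact: disj.
Qed.

(** An isometry maps nets to nets; this is the whole source of the invariance of
    the measure built from covering numbers. *)
Lemma covnum_isometry (phi psi : T -> T) A e : 0 < e ->
  cancel psi phi -> (forall x y, D (phi x) (phi y) = D x y) ->
  (covnum (phi @^-1` A) e <= covnum A e)%N.
Proof.
move=> e0 K iso; have [_ minA] := covnumP (phi @^-1` A) e0.
have [[s <- cs] _] := covnumP A e0; rewrite -(size_map psi); apply: minA.
move=> y /cs[x xs xy]; exists (psi x); first exact: map_f.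
by rewrite -iso K.
Qed.

End CoveringNumbers.

Section UltraLimit.
Context {R : realType}.
Variables (U : set_system nat) (UU : UltraFilter U).

(** Bounded sequences converge along an ultrafilter; the limit is additive and
    monotone, which is all that is needed to turn the asymptotically additive
    covering ratios into an additive content. *)
Definition ulim (u : nat -> R) : R := lim (u @ U).

Lemma ulim_cvg (u : nat -> R) : (forall n, 0 <= u n <= 1) -> u @ U --> ulim u.
Proof.
move=> u01.
have H : (u @ U) `[0, 1]%classic.
  apply: (@filterS _ U _ setT) => [n _ /=|]; last exact: filterT.
  by rewrite in_itv; exact: u01.
have := @segment_compact R 0 1; rewrite compact_ultra => /(_ (u @ U) _ H).
move=> [|p [_ up]]; last by apply: cvgP up.
split=> [|V VF sub]; first by apply: fmap_proper_filter.
apply: eq_set => A; apply: propext; split=> [VA|]; last exact: sub.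
have [|UnA] := in_ultra_setVsetC (u @^-1` A) UU; first by [].
have /(_ UnA) VnA := sub (~` A).
by have [y []] := filter_ex (filterI VA VnA).
Qed.

Lemma ulim_le (u v : nat -> R) : (forall n, 0 <= u n <= 1) ->
  (forall n, 0 <= v n <= 1) -> U [set n | u n <= v n] -> ulim u <= ulim v.
Proof. by move=> /ulim_cvg uc /ulim_cvg vc uv; exact: ler_cvg_to uc vc uv. Qed.

Lemma ulimD_le (u v w : nat -> R) : (forall n, 0 <= u n <= 1) ->
  (forall n, 0 <= v n <= 1) -> (forall n, 0 <= w n <= 1) ->
  U [set n | u n <= v n + w n] -> ulim u <= ulim v + ulim w.
Proof.
move=> /ulim_cvg uc /ulim_cvg vc /ulim_cvg wc uvw.
exact: ler_cvg_to uc (cvgD vc wc) uvw.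
Qed.

Lemma ulimD_ge (u v w : nat -> R) : (forall n, 0 <= u n <= 1) ->
  (forall n, 0 <= v n <= 1) -> (forall n, 0 <= w n <= 1) ->
  U [set n | v n + w n <= u n] -> ulim v + ulim w <= ulim u.
Proof.
move=> /ulim_cvg uc /ulim_cvg vc /ulim_cvg wc uvw.
exact: ler_cvg_to (cvgD vc wc) uc uvw.
Qed.

Lemma ulim_cst (c : R) : 0 <= c <= 1 -> ulim (fun=> c) = c.
Proof. by move=> c01; apply: cvg_lim => //; exact: cvg_cst. Qed.

End UltraLimit.

(** * Carathéodory's criterion for the sublevels of a function *)

Section CaratheodoryCriterion.
Context {R : realType} {T : Type}.
Variables (mu : {outer_measure set T -> \bar R}) (h : T -> R).
Local Open Scope ereal_scope.

Hypothesis mu_fin : forall X, mu X < +oo.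
Hypothesis mu_sep : forall (A B : set T) (r : R), (0 < r)%R ->
  (forall x y, A x -> B y -> h x + r <= h y)%R ->
  mu A + mu B <= mu (A `|` B).

Let a (n : nat) : R := n.+1%:R^-1.

Let a_gt0 n : (0 < a n)%R. Proof. by rewrite /a invr_gt0. Qed.

Let a_decr m n : (m < n)%N -> (a n < a m)%R.
Proof. by move=> mn; rewrite /a ltf_pV2 ?posrE// ltr_nat ltnS. Qed.

Let far (X : set T) n := X `&` [set x | a n <= h x]%R.
Let shell (X : set T) n := X `&` [set x | a n.+2 <= h x < a n.+1]%R.

(* Only every other shell is separated from the rest, whence the two terms on
   the right. *)
Let shell_sum X n :
  \sum_(k < n) mu (shell X k) <= mu (far X n) + mu (far X n.+1).
Proof.
elim: n => [|n IHn]; first by rewrite big_ord0 adde_ge0 ?outer_measure_ge0.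
rewrite big_ord_recr/=; apply: le_trans (leeD2r _ IHn) _.
rewrite addeAC addeC; apply: leeD2l.
apply: le_trans (_ : mu (shell X n `|` far X n) <= _).
  rewrite addeC; apply: (@mu_sep _ _ (a n - a n.+1)%R).
    by rewrite subr_gt0 a_decr.
  by move=> x y [_ /andP[_ /ltW hx]] [_ /= hy]; lra.
apply: le_outer_measure => x [[Xx /andP[ax _]]|[Xx ax]]; split => //=.
by apply: le_trans ax; apply/ltW/a_decr.
Qed.

Let far_shells X n :
  X `&` ~` [set x | h x <= 0]%R `<=`
  far X n.+1 `|` \bigcup_(k in ~` `I_n) shell X k.
Proof.
move=> x [Xx /negP]; rewrite -ltNge => hx0.
have ex : exists m, (a m <= h x)%R.
  have [N _ /(_ N (leqnn N)) HN] := near_infty_natSinv_lt (PosNum hx0).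
  by exists N; exact: ltW.
case: (ex_minnP ex) => m am mmin.
have [mn|nm] := leqP m n.+1.
  left; split => //=; apply: le_trans am.
  by move: mn; rewrite leq_eqVlt => /predU1P[->//|/a_decr/ltW].
right; case: m => [|[|m]] // in am mmin nm *; exists m => /=.
  by apply/negP; rewrite -leqNgt -ltnS -ltnS.
split=> //=; rewrite am ltNge/=; apply/negP => /mmin.
by rewrite ltnn.
Qed.

(** Carathéodory's criterion, for a real function in place of a distance to a
    closed set: the part of a test set where the function is small positive is
    negligible because the shells between consecutive levels have summable
    measure. *)
Lemma caratheodory_sublevel : mu.-caratheodory [set x | h x <= 0]%R.
Proof.
apply: le_caratheodory_measurable => X; set F := [set x | _].
have bnd n : mu (X `&` F) + mu (far X n) <= mu X.
  apply: le_trans (mu_sep (a_gt0 n) _) _.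
    by move=> x y [_ hx] [_ hy]; apply: le_trans hy; rewrite gerDr.
  by apply: le_outer_measure => x [|] [].
have summable : \sum_(0 <= k <oo) mu (shell X k) < +oo.
  apply: (@le_lt_trans _ _ (mu X + mu X)).
    apply: lime_le; first by apply: is_cvg_nneseries => *; exact: outer_measure_ge0.
    apply: nearW => n; rewrite big_mkord; apply: le_trans (shell_sum X n) _.
    by apply: leeD; apply: le_outer_measure => x [].
  by rewrite lte_add_pinfty.
have tail := nneseries_tail_cvg summable (fun k _ => outer_measure_ge0 mu _).
apply/lee_addgt0Pr => e e0.
have [N _ /(_ N (leqnn N)) tN] : \forall N \near \oo,
    \sum_(N <= k <oo) mu (shell X k) <= e%:E.
  have : nbhs (0 : \bar R) [set y | y < e%:E].
    by apply: open_nbhs_nbhs; split; [exact: open_ereal_lt_ereal|rewrite /= lte_fin].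
  by move=> /tail[M _ HM]; exists M => // n /HM/ltW.
apply: (@le_trans _ _ (mu (X `&` F) + (mu (far X N.+1) + e%:E))); last first.
  by rewrite addeA; apply/leeD2r/bnd.
apply: leeD2l; apply: le_trans (le_outer_measure mu _ _ (@far_shells X N)) _.
apply: le_trans (outer_measureU2 _ _ _) _; apply: leeD2l.
apply: le_trans _ tN; exact: outer_measure_sigma_subadditive_tail.
Qed.

End CaratheodoryCriterion.

(** * Isometry-invariant measures on compact pseudometric spaces *)

Section InvariantMeasure.
Context {R : realType} {T : pointedType}.
Variable D : T -> T -> R.
Implicit Types (A B V : set T) (e : R).

Definition dist_open V := forall x, V x -> exists2 e, 0 < e &
  forall y, D x y < e -> V y.

Hypothesis Dxx : forall x, D x x = 0.
Hypothesis Dsym : forall x y, D x y = D y x.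
Hypothesis Dtri : forall y x z, D x z <= D x y + D y z.
Hypothesis Dtb : forall e, 0 < e -> exists s, net_covers D setT e s.
Hypothesis Dcompact : forall F : nat -> set T, (forall n, dist_open (F n)) ->
  (forall x, exists n, F n x) ->
  exists n, forall x, exists2 i, (i < n)%N & F i x.

Lemma dist_open0 : dist_open set0.
Proof. by []. Qed.

Lemma dist_openT : dist_open setT.
Proof. by move=> x _; exists 1. Qed.

Lemma dist_openI V W : dist_open V -> dist_open W -> dist_open (V `&` W).
Proof.
move=> oV oW x [/oV[e e0 eV] /oW[f f0 fW]].
exists (Num.min e f); first by rewrite lt_min e0 f0.
by move=> y; rewrite lt_min => /andP[/eV ? /fW ?].
Qed.

Lemma dist_open_thickening A e : dist_open [set z | exists2 x, A x & D x z < e].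
Proof.
move=> z [x Ax xz]; exists (e - D x z); first by rewrite subr_gt0.
by move=> y zy; exists x => //; have := Dtri z x y; lra.
Qed.

Lemma dist_open_isometry (phi : T -> T) V :
  (forall x y, D (phi x) (phi y) = D x y) -> dist_open V ->
  dist_open (phi @^-1` V).
Proof.
by move=> iso oV x /oV[e e0 eV]; exists e => // y xy; apply: eV; rewrite iso.
Qed.

Let radius (n : nat) : R := n.+1%:R^-1.

Let radius_gt0 n : 0 < radius n. Proof. by rewrite invr_gt0. Qed.

Let cover_ratio A n : R :=
  (covnum Dtb A (radius n))%:R / (covnum Dtb setT (radius n))%:R.

Let coverT_gt0 n : 0 < (covnum Dtb setT (radius n))%:R :> R.
Proof. by rewrite ltr0n covnum_gt0//; exists point. Qed.

Let cover_ratio01 A n : 0 <= cover_ratio A n <= 1.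
Proof.
by rewrite divr_ge0//= ler_pdivrMr// mul1r ler_nat covnum_le.
Qed.

Variable U : set_system nat.
Hypotheses (UU : UltraFilter U) (Uoo : \oo `<=` U).

Let content A : R := ulim U (cover_ratio A).

Let content_ge0 A : 0 <= content A.
Proof.
rewrite -(@ulim_cst _ _ UU 0) ?lexx ?ler01//; apply: (ulim_le UU) => //.
- by move=> n; rewrite lexx ler01.
- by apply: filterS (@filterT _ U _) => n _ /=; case/andP: (cover_ratio01 A n).
Qed.

Let content0 : content set0 = 0.
Proof.
rewrite /content (_ : cover_ratio set0 = fun=> 0) ?ulim_cst ?lexx ?ler01//.
by apply/funext => n; rewrite /cover_ratio covnum0// mul0r.
Qed.

Let contentT : content setT = 1.
Proof.
rewrite /content (_ : cover_ratio setT = fun=> 1) ?ulim_cst ?lexx ?ler01//.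
by apply/funext => n; rewrite /cover_ratio divff// gt_eqF.
Qed.

Let content_le A B : A `<=` B -> content A <= content B.
Proof.
move=> AB; apply: (ulim_le UU) => //; apply: filterS (@filterT _ U _) => n _ /=.
by rewrite ler_pM2r ?invr_gt0// ler_nat covnum_le.
Qed.

Let contentU_le A B : content (A `|` B) <= content A + content B.
Proof.
apply: (ulimD_le UU) => //; apply: filterS (@filterT _ U _) => n _ /=.
by rewrite -mulrDl ler_pM2r ?invr_gt0// -natrD ler_nat covnumU_le.
Qed.

(* Additivity for sets at positive distance, the only one that the criterion of
   Carathéodory asks for. *)
Let contentU_ge A B r : 0 < r -> (forall x y, A x -> B y -> r <= D x y) ->
  content A + content B <= content (A `|` B).
Proof.
move=> r0 sep; apply: (ulimD_ge UU) => //; apply: Uoo.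
have r20 : 0 < r / 2 by rewrite divr_gt0.
apply: filterS (near_infty_natSinv_lt (PosNum r20)) => n /= nr.
rewrite -mulrDl ler_pM2r ?invr_gt0// -natrD ler_nat.
apply: covnumU_ge => // x y Ax By.
apply: le_trans (sep _ _ Ax By); rewrite mulrC -ler_pdivlMr//; exact: ltW nr.
Qed.

Let content_isometry (phi psi : T -> T) A : cancel psi phi ->
  (forall x y, D (phi x) (phi y) = D x y) ->
  content (phi @^-1` A) <= content A.
Proof.
move=> K iso; apply: (ulim_le UU) => //; apply: filterS (@filterT _ U _) => n _.
by rewrite /= ler_pM2r ?invr_gt0// ler_nat (covnum_isometry _ _ _ K).
Qed.

Local Open Scope ereal_scope.

(* Infinite weight off the open sets restricts the covers to open ones. *)
Let weight A : \bar R := if `[< dist_open A >] then (content A)%:E else +oo.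

Let weightE V : dist_open V -> weight V = (content V)%:E.
Proof. by move=> oV; rewrite /weight; case: asboolP. Qed.

Let weight_ge0 A : 0 <= weight A.
Proof. by rewrite /weight; case: asboolP; rewrite ?lee_fin ?leey. Qed.

Let weight0 : weight set0 = 0.
Proof. by rewrite weightE ?content0//; exact: dist_open0. Qed.

Let P := g_sigma_algebraType (@setT (set T)).

Let outer : set T -> \bar R := @mu_ext _ P R weight.

HB.instance Definition _ := isOuterMeasure.Build R T outer
  (@mu_ext0 _ P R weight weight0 weight_ge0)
  (@mu_ext_ge0 _ P R weight weight_ge0)
  (@le_mu_ext _ P R weight)
  (@mu_ext_sigma_subadditive _ P R weight weight_ge0).

Let outer_le A (F : nat -> set T) : A `<=` \bigcup_k F k ->
  outer A <= \sum_(k <oo) weight (F k).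
Proof.
move=> AF; apply: ereal_inf_lbound; exists F => //; split => // k.
exact: sub_sigma_algebra.
Qed.

Let le_outer A (c : \bar R) : (forall F : nat -> set T,
    (forall k, dist_open (F k)) -> A `<=` \bigcup_k F k ->
    c <= \sum_(k <oo) weight (F k)) -> c <= outer A.
Proof.
move=> H; apply: le_ereal_inf_tmp => _ [F [_ AF] <-].
have [oF|/existsNP[k nFk]] := pselect (forall k, dist_open (F k)); first exact: H.
rewrite (@eseries_pinfty _ _ _ k) ?leey// => [n _|].
  by rewrite -ltNye (lt_le_trans _ (weight_ge0 _)).
by rewrite /weight; case: asboolP.
Qed.

(* Total mass at most 1 is clear; at least 1 needs compactness, since the content
   is only finitely subadditive. *)
Let outerT : outer setT = 1.
Proof.
apply/eqP; rewrite eq_le; apply/andP; split.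
  apply: le_trans (@outer_le setT (fun k => if k is 0%N then setT else set0) _) _.
    by move=> x _; exists 0%N.
  rewrite nneseries_recl//= weightE ?contentT; last exact: dist_openT.
  by rewrite eseries_cond/= eseries0 ?adde0// => -[|]//= k _ _.
apply: le_outer => F oF FT.
have [|n Fn] := Dcompact oF; first by move=> x; have [k _] := FT x I; exists k.
apply: (@le_trans _ _ (\sum_(0 <= k < n) weight (F k))); last first.
  by apply: nneseries_lim_ge.
rewrite big_mkord -contentT.
apply: (@le_trans _ _ (content (\big[setU/set0]_(k < n) F k))%:E).
  rewrite lee_fin; apply: content_le => x _; have [k kn Fk] := Fn x.
  by rewrite -bigcup_mkord; exists k.
elim: n {Fn} => [|n IHn]; first by rewrite !big_ord0 content0.
rewrite !big_ord_recr/=; apply: le_trans (leeD2r _ IHn).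
by rewrite weightE// -EFinD lee_fin.
Qed.

Let outer_fin A : outer A < +oo.
Proof.
apply: le_lt_trans (@le_mu_ext _ P R weight A setT (@subsetT _ A)) _.
by rewrite -/outer outerT ltry.
Qed.

Let outer_sep A B (r : R) : (0 < r)%R ->
  (forall x y, A x -> B y -> r <= D x y)%R ->
  outer A + outer B <= outer (A `|` B).
Proof.
move=> r0 sep; apply: le_outer => F oF FAB.
pose thick (C : set T) := [set z | exists2 x, C x & D x z < r / 3]%R.
have othick C : dist_open (thick C) by exact: dist_open_thickening.
have sub (C : set T) : C `<=` A `|` B -> outer C <= \sum_(k <oo) weight (F k `&` thick C).
  move=> CAB; apply: outer_le => x Cx; have [k _ Fx] := FAB _ (CAB _ Cx).
  by exists k => //; split => //; exists x => //; rewrite Dxx divr_gt0.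
apply: le_trans (leeD (sub A _) (sub B _)) _; [by left|by right|].
rewrite -nneseriesD//; apply: lee_nneseries => k _; first by rewrite adde_ge0.
rewrite !weightE//; [|exact: dist_openI..].
rewrite -EFinD lee_fin.
apply: (@le_trans _ _ (content (F k `&` thick A `|` F k `&` thick B))); last first.
  by apply: content_le => x [[]|[]].
apply: (@contentU_ge _ _ (r / 3)%R); first by rewrite divr_gt0.
move=> x y [_ [a Aa ax]] [_ [b Bb yb]]; have := sep _ _ Aa Bb.
have := Dtri x a b; have := Dtri y x b; rewrite (Dsym y b); lra.
Qed.

Let outer_isometry_le (phi psi : T -> T) A :
  cancel psi phi -> (forall x y, D (phi x) (phi y) = D x y) ->
  outer (phi @^-1` A) <= outer A.
Proof.
move=> K iso; apply: le_outer => F oF AF.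
apply: le_trans (@outer_le _ (fun k => phi @^-1` (F k)) _) _.
  by move=> x /AF[k _ Fk]; exists k.
apply: lee_nneseries => // k _.
rewrite !weightE//; last exact: dist_open_isometry.
by rewrite lee_fin (content_isometry _ K).
Qed.

Lemma invariant_outer_measure_along : exists mu : {outer_measure set T -> \bar R},
  [/\ mu setT = 1,
      forall (phi psi : T -> T) A, cancel phi psi -> cancel psi phi ->
        (forall x y, D (phi x) (phi y) = D x y) -> mu (phi @^-1` A) = mu A &
      forall x e, mu.-caratheodory [set y | D x y < e]%R].
Proof.
exists outer; split; first exact: outerT.
  move=> phi psi A K1 K2 iso; apply/eqP; rewrite eq_le.
  rewrite (outer_isometry_le _ K2)//=.
  have -> : A = psi @^-1` (phi @^-1` A) by apply/funext => x /=; rewrite K2.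
  rewrite [in leRHS](_ : phi @^-1` _ = phi @^-1` A); last first.
    by apply/funext => x /=; rewrite !K2.
  by apply: (outer_isometry_le _ K1) => x y; rewrite -iso !K2.
move=> x e.
have -> : [set y | D x y < e]%R = ~` [set y | e - D x y <= 0]%R.
  apply/funext => y; apply/propext => /=; rewrite subr_le0 leNgt.
  by split=> [->//|/negP]; rewrite negbK.
apply: caratheodory_measurable_setC; apply: caratheodory_sublevel => // A B r r0 sep.
apply: (outer_sep r0) => y z Ay Bz; have := sep _ _ Ay Bz.
have := Dtri z x y; rewrite (Dsym z y); lra.
Qed.

End InvariantMeasure.

(** The limit of normalized covering numbers along an ultrafilter is a content that
    isometries preserve and that is additive on sets at positive distance; covering
    by open sets turns it into a metric outer measure. For a right-invariant
    pseudometric on a group it plays the role of Haar measure. *)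
Theorem isometry_invariant_outer_measure (R : realType) (T : pointedType)
    (D : T -> T -> R) :
  (forall x, D x x = 0) -> (forall x y, D x y = D y x) ->
  (forall y x z, D x z <= D x y + D y z) ->
  (forall e, 0 < e -> exists s, net_covers D setT e s) ->
  (forall F : nat -> set T, (forall n, dist_open D (F n)) ->
    (forall x, exists n, F n x) ->
    exists n, forall x, exists2 i, (i < n)%N & F i x) ->
  exists mu : {outer_measure set T -> \bar R},
  [/\ mu setT = 1%E,
      forall (phi psi : T -> T) A, cancel phi psi -> cancel psi phi ->
        (forall x y, D (phi x) (phi y) = D x y) -> mu (phi @^-1` A) = mu A &
      forall x e, mu.-caratheodory [set y | D x y < e]].
Proof.
move=> Dxx Dsym Dtri Dtb Dcompact.
have [U [UU Uoo]] := ultraFilterLemma eventually_filter.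
exact: (invariant_outer_measure_along Dxx Dsym Dtri Dtb Dcompact UU Uoo).
Qed.

(** * The least cost among couplings of given level laws *)

Lemma measurable_set_le (R : realType) d (T : measurableType d) (f g : T -> R) :
  measurable_fun setT f -> measurable_fun setT g ->
  measurable [set x | f x <= g x].
Proof.
by move=> mf mg; rewrite -[X in measurable X]setTI; apply: measurable_fun_le.
Qed.

Lemma measurable_set_lt (R : realType) d (T : measurableType d) (f g : T -> R) :
  measurable_fun setT f -> measurable_fun setT g ->
  measurable [set x | f x < g x].
Proof.
move=> mf mg; rewrite (_ : [set x | _] = ~` [set x | g x <= f x]).
  by apply: measurableC; exact: measurable_set_le.
by apply/seteqP; split => x /=; rewrite ltNge => /negP.
Qed.

Section ComonotoneCost.
Context {R : realType}.
Local Open Scope ereal_scope.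
Local Notation RR := (measurableTypeR R * measurableTypeR R)%type.

Let leb : {sigma_finite_measure set (measurableTypeR R) -> \bar R} :=
  @lebesgue_measure R.
Definition plane_lebesgue : set RR -> \bar R := leb \x leb.
Local Notation leb2 := plane_lebesgue.

HB.instance Definition _ := Measure.on leb2.

Let leb2_sigma_finite : sigma_finite setT leb2.
Proof.
have /sigma_finiteP[F [TF ndF Foo]] := sigma_finiteT leb.
exists (fun n => F n `*` F n).
  apply/seteqP; split => // -[x y] _.
  have : setT x by []; have : setT y by []; rewrite TF => -[n _ Fy] [k _ Fx].
  exists (maxn n k) => //; split => /=.
    by move: x Fx; exact/subsetPset/ndF/leq_maxr.
  by move: y Fy; exact/subsetPset/ndF/leq_maxl.
move=> k; have [mF finF] := Foo k; split; first exact: measurableX.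
by rewrite /leb2 product_measure1E// lte_mul_pinfty// ge0_fin_numE.
Qed.

HB.instance Definition _ := Measure_isSigmaFinite.Build _ _ _ leb2
  leb2_sigma_finite.

Section LayerCake.
Context d (T : measurableType d) (P : probability T R) (a b : T -> R).
Hypotheses (ma : measurable_fun setT a) (mb : measurable_fun setT b).

Let E : set (T * RR) := [set z | [/\ (b z.1 <= z.2.1)%R, (b z.1 <= z.2.2)%R,
  (z.2.1 < a z.1)%R & (z.2.2 < a z.1)%R]].

Let mE : measurable E.
Proof.
have m1 : measurable_fun setT (fun z : T * RR => z.2.1).
  exact: measurableT_comp measurable_fst measurable_snd.
have m2 : measurable_fun setT (fun z : T * RR => z.2.2).
  exact: measurableT_comp measurable_snd measurable_snd.
have mA : measurable_fun setT (fun z : T * RR => a z.1).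
  exact: measurableT_comp ma measurable_fst.
have mB : measurable_fun setT (fun z : T * RR => b z.1).
  exact: measurableT_comp mb measurable_fst.
rewrite (_ : E = [set z | b z.1 <= z.2.1]%R `&` [set z | b z.1 <= z.2.2]%R `&`
    ([set z | z.2.1 < a z.1]%R `&` [set z | z.2.2 < a z.1]%R)); last first.
  by apply/seteqP; split => z [] => [? ? ? ?|[? ?] []].
by apply: measurableI; apply: measurableI;
  [apply: measurable_set_le|apply: measurable_set_le|
   apply: measurable_set_lt|apply: measurable_set_lt].
Qed.

(** Layer-cake formula: the square of the positive part of a - b is the area of
    the square with side from b to a, and Tonelli exchanges area and
    probability. *)
Lemma integral_gap_sqr :
  \int[P]_x ((Num.max (a x - b x) 0) ^+ 2)%:E =
  \int[leb2]_st P [set x | [/\ (b x <= st.1)%R, (b x <= st.2)%R,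
    (st.1 < a x)%R & (st.2 < a x)%R]].
Proof.
have := indic_fubini_tonelli P leb2 mE.
rewrite indic_fubini_tonelli_FE// indic_fubini_tonelli_GE// => tonelli.
transitivity (\int[P]_x (leb2 \o xsection E) x).
  apply: eq_integral => x _ /=.
  rewrite (_ : xsection E x = `[b x, a x[%classic `*` `[b x, a x[%classic).
    rewrite /leb2 product_measure1E// /leb /= lebesgue_measure_itv/= lte_fin.
    case: ltP => ab; first by rewrite max_l ?subr_ge0 1?ltW.
    by rewrite mul0e max_r ?subr_le0// expr0n.
  rewrite xsectionE; apply/seteqP; split => [[s t] /= [? ? ? ?]|[s t] /= []].
    by rewrite !in_itv/=; split; apply/andP.
  by rewrite !in_itv/= => /andP[? ?] /andP[? ?].
rewrite tonelli; apply: eq_integral => y _ /=; congr (P _).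
by rewrite ysectionE.
Qed.

Lemma measurable_gap_prob : measurable_fun setT (fun st : RR =>
  P [set x | [/\ (b x <= st.1)%R, (b x <= st.2)%R,
    (st.1 < a x)%R & (st.2 < a x)%R]]).
Proof.
have := measurable_fun_ysection P mE; apply: eq_measurable_fun => st _ /=.
by rewrite ysectionE.
Qed.

End LayerCake.

(** The cost is an integral of probabilities of events b <= s < t < a, and for a
    comonotone pair each of them has the least probability that the laws of a and b
    allow. *)
Lemma comonotone_cost_le d (T : measurableType d) (P : probability T R)
    d' (T' : measurableType d') (P' : probability T' R)
    (a b : T -> R) (a' b' : T' -> R) :
  measurable_fun setT a -> measurable_fun setT b ->
  measurable_fun setT a' -> measurable_fun setT b' ->
  (forall s, P [set x | a x <= s]%R = P' [set x | a' x <= s]%R) ->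
  (forall s, P [set x | b x <= s]%R = P' [set x | b' x <= s]%R) ->
  (forall s t, [set x | a x <= s]%R `<=` [set x | b x <= t]%R \/
               [set x | b x <= t]%R `<=` [set x | a x <= s]%R) ->
  \int[P]_x ((Num.max (a x - b x) 0) ^+ 2)%:E <=
  \int[P']_x ((Num.max (a' x - b' x) 0) ^+ 2)%:E.
Proof.
move=> ma mb ma' mb' Ea Eb com; rewrite !integral_gap_sqr//.
apply: ge0_le_integral => //.
- exact: measurable_gap_prob.
- exact: measurable_gap_prob.
move=> [s t] _ /=.
pose lo := Num.min s t; pose hi := Num.max s t.
have mle e (S : measurableType e) (f : S -> R) r : measurable_fun setT f ->
    measurable [set x | f x <= r]%R.
  by move=> mf; apply: measurable_set_le.
have gapE S (f g : S -> R) : [set x | [/\ (g x <= s)%R, (g x <= t)%R,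
    (s < f x)%R & (t < f x)%R]] =
    [set x | g x <= lo]%R `\` [set x | f x <= hi]%R.
  rewrite /lo /hi; apply/seteqP; split => x /=.
    move=> [? ? ? ?]; rewrite le_min; split; first by apply/andP.
    by apply/negP; rewrite -ltNge gt_max; apply/andP.
  rewrite le_min => -[/andP[-> ->] /negP]; rewrite -ltNge gt_max.
  by move=> /andP[-> ->].
rewrite !gapE; case: (com hi lo) => sub; last first.
  rewrite (_ : _ `\` _ = set0) ?measure0//.
  by apply/seteqP; split => // x [/sub].
rewrite measureD//; try exact: mle; last by rewrite ltey_eq fin_num_measure//; exact: mle.
rewrite setIidr// [X in X - _](Eb lo) [X in _ - X](Ea hi).
rewrite measureD//; try exact: mle; last by rewrite ltey_eq fin_num_measure//; exact: mle.
apply: leeB => //; apply: le_measure; rewrite ?inE; [|exact: mle|exact: subIsetr].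
by apply: measurableI; exact: mle.
Qed.

End ComonotoneCost.

(** * The uniform law on the unit interval and quantile functions *)

Lemma push_probability d d' (T : measurableType d) (T' : measurableType d')
    (R : realType) (P : probability T R) (f : T -> T') : measurable_fun setT f ->
  exists Q : probability T' R, Q = pushforward P f :> (set T' -> \bar R).
Proof.
move=> mf; pose F : {mfun T >-> T'} := HB.pack f (isMeasurableFun.Build _ _ _ _ f mf).
by exists (distribution P F).
Qed.

Section Quantile.
Context {R : realType}.
Local Open Scope ereal_scope.
Local Notation TR := (measurableTypeR R).

Let m01 : measurable (`]0%R, 1%R[%classic : set TR).
Proof. exact: measurable_itv. Qed.

Definition unit_lebesgue : set TR -> \bar R := mrestr (@lebesgue_measure R) m01.

HB.instance Definition _ := Measure.on unit_lebesgue.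

Let unit_lebesgueT : unit_lebesgue setT = 1.
Proof.
by rewrite /unit_lebesgue /mrestr setTI lebesgue_measure_itv/= lte_fin ltr01 oppr0 adde0.
Qed.

HB.instance Definition _ :=
  Measure_isProbability.Build _ _ _ unit_lebesgue unit_lebesgueT.

Lemma unit_lebesgue_itv (c : R) : (0 <= c <= 1)%R ->
  unit_lebesgue `]-oo, c]%classic = c%:E.
Proof.
move=> /andP[c0 c1]; rewrite /unit_lebesgue /mrestr.
have [->|cn1] := eqVneq c 1%R.
  rewrite (_ : _ `&` _ = `]0%R, 1%R[%classic).
    by rewrite lebesgue_measure_itv/= lte_fin ltr01 oppr0 adde0.
  apply/seteqP; split => x /=; rewrite !in_itv/=; first by case.
  by move=> /andP[x0 x1]; rewrite x0 x1 ltW.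
rewrite (_ : _ `&` _ = `]0%R, c]%classic).
  rewrite lebesgue_measure_itv/= lte_fin; have [c00|c00] := ltP 0%R c.
    by rewrite oppr0 adde0.
  by congr EFin; apply/eqP; rewrite eq_le c0 c00.
apply/seteqP; split => x /=; rewrite !in_itv/=.
  by move=> [-> /andP[-> _]].
move=> /andP[-> xc]; split => //=; apply: le_lt_trans xc _.
by rewrite lt_neqAle cn1.
Qed.

(** The quantile function of P: a generalized inverse of its distribution function.
    That it is nondecreasing makes two such functions comonotone. *)
Lemma quantile_exists (P : probability R R) (a b : R) :
  P `[a, b]%classic = 1 ->
  exists q : TR -> R,
  [/\ measurable_fun setT q, {homo q : u v / (u <= v)%R},
      forall u, (a <= q u <= b)%R &
      forall B : set R, measurable B -> unit_lebesgue (q @^-1` B) = P B].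
Proof.
move=> Pab.
have ab : (a <= b)%R.
  rewrite leNgt; apply/negP => ba; move: Pab; rewrite set_itv_ge ?measure0.
    by move=> /eqP; rewrite lt_eqF// lte_fin ltr01.
  by rewrite bnd_simp -ltNge.
have mle s : measurable (`]-oo, s]%classic : set R) by exact: measurable_itv.
pose F s := fine (P `]-oo, s]%classic).
have PF s : P `]-oo, s]%classic = (F s)%:E by rewrite fineK// fin_num_measure.
have F01 s : (0 <= F s <= 1)%R.
  by rewrite fine_ge0//= -lee_fin -PF probability_le1.
have Fmono s t : (s <= t)%R -> (F s <= F t)%R.
  move=> st; rewrite -lee_fin -!PF; apply: le_measure; rewrite ?inE//.
  by apply: subset_itvl; rewrite bnd_simp.
have Fb s : (b <= s)%R -> F s = 1%R.
  move=> bs; apply/eqP; rewrite eq_le; have /andP[_ ->] := F01 s => /=.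
  rewrite -lee_fin -PF -Pab; apply: le_measure; rewrite ?inE//.
  by apply: subset_itv; rewrite bnd_simp.
have Fa s : (s < a)%R -> F s = 0%R.
  move=> sa; apply/eqP; rewrite -eqe -PF; apply/eqP.
  have PC : P (~` `[a, b]%classic) = 0.
    by rewrite probability_setC// Pab subee.
  apply: (subset_measure0 _ _ _ PC) => //; first exact: measurableC.
  move=> x /=; rewrite !in_itv/= => xs /andP[ax _].
  by have := le_lt_trans (le_trans ax xs) sa; rewrite ltxx.
(* right continuity *)
have Frc s u : (forall t, s < t -> u <= F t)%R -> (u <= F s)%R.
  move=> us; rewrite -lee_fin -PF.
  have <- : \bigcap_n `]-oo, (s + n.+1%:R^-1)%R]%classic = `]-oo, s]%classic.
    apply/seteqP; split => x /=.
      move=> H; rewrite in_itv/=; apply/ler_addgt0Pr => e e0.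
      have [N _ /(_ N (leqnn N)) HN] := near_infty_natSinv_lt (PosNum e0).
      have := H N I; rewrite /= in_itv/= => /le_trans; apply.
      by rewrite lerD2l; exact: ltW HN.
    rewrite in_itv/= => xs n _; rewrite /= in_itv/=; apply: le_trans xs _.
    by rewrite lerDl.
  have cvgP := @nonincreasing_cvg_mu _ _ _ P
    (fun n => `]-oo, (s + n.+1%:R^-1)%R]%classic).
  have /cvg_lim <-// : P `]-oo, (s + n.+1%:R^-1)%R]%classic @[n --> \oo] -->
      P (\bigcap_n `]-oo, (s + n.+1%:R^-1)%R]%classic).
    apply: cvgP => //.
    - by rewrite ltey_eq fin_num_measure.
    - exact: bigcapT_measurable.
    - move=> m n mn; apply/subsetPset/subset_itvl; rewrite bnd_simp lerD2l.
      by rewrite lef_pV2 ?posrE// ler_nat.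
  apply: lime_ge.
    apply: ereal_nonincreasing_is_cvgn => m n mn; apply: le_measure; rewrite ?inE//.
    by apply: subset_itvl; rewrite bnd_simp lerD2l lef_pV2 ?posrE// ler_nat.
  by apply: nearW => n; rewrite PF lee_fin us// ltrDl.
pose S u := [set s | (a <= s <= b)%R /\ (s = b \/ u <= F s)%R].
pose q (u : TR) : R := inf (S u).
have Sb u : S u b by split; [rewrite ab lexx|left].
have Slb u : has_inf (S u).
  by split; [exists b|exists a => s [/andP[]]].
have qab u : (a <= q u <= b)%R.
  apply/andP; split; last by apply: ge_inf; [case: (Slb u)|].
  by apply: lb_le_inf; [exists b|move=> s [/andP[]]].
have qmono : {homo q : u v / (u <= v)%R}.
  move=> u v uv; apply: lb_le_inf; first by exists b.
  move=> s [sab bs]; apply: ge_inf; first by case: (Slb u).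
  by split=> //; case: bs => [|us]; [left|right; exact: le_trans us].
have qle u s : (a <= s < b)%R -> (q u <= s)%R = (u <= F s)%R.
  move=> /andP[as_ sb]; apply/idP/idP => [qus|us]; last first.
    apply: ge_inf; first by case: (Slb u).
    by split; [rewrite as_ ltW|right].
  apply: Frc => t st; have [bt|tb] := leP b t.
    rewrite Fb//.
    have [t0 [_ [t0b|ut0]] t0t] : exists2 t, S u t & (t < b)%R.
      exact: (inf_lt (ex_intro _ b (Sb u)) (le_lt_trans qus sb)).
    - by move: t0t; rewrite t0b ltxx.
    - by apply: le_trans ut0 _; case/andP: (F01 t0).
  have [t0 [_ [t0b|ut0]] t0t] : exists2 t0, S u t0 & (t0 < t)%R.
    exact: (inf_lt (ex_intro _ b (Sb u)) (le_lt_trans qus st)).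
  - by move: t0t; rewrite t0b ltNge (ltW tb).
  - by apply: le_trans ut0 _; apply/Fmono/ltW.
have mq : measurable_fun setT q.
  exact: (@nondecreasing_measurable _ setT (q : R -> R)).
have law s : unit_lebesgue (q @^-1` `]-oo, s]%classic) = P `]-oo, s]%classic.
  rewrite PF; have [sa|as_] := ltP s a.
    rewrite Fa// (_ : _ @^-1` _ = set0) ?measure0//.
    apply/seteqP; split => // u /=; rewrite in_itv/= => qs.
    by have /andP[aq _] := qab u; have := le_lt_trans (le_trans aq qs) sa; rewrite ltxx.
  have [bs|sb] := leP b s.
    rewrite Fb// (_ : _ @^-1` _ = setT) ?probability_setT//.
    by apply/seteqP; split => // u _ /=; rewrite in_itv/=; have /andP[_ /le_trans] := qab u; apply.
  rewrite -unit_lebesgue_itv//; congr unit_lebesgue.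
  by apply/seteqP; split => u /=; rewrite !in_itv/= qle// as_ sb.
exists q; split => // B mB.
have [L LE] := push_probability unit_lebesgue mq.
rewrite -[LHS]/(pushforward unit_lebesgue q B) -LE.
apply: (@measure_unique _ R R (@ocitv R) (fun n => `]- n%:R, n%:R]%classic)%R _ _ _ _ L P) => //.
- exact: ocitvI.
- by move=> n; exists (- n%:R, n%:R)%R.
- by rewrite bigcup_itvT.
- move=> _ [[r s] _ <-] /=.
  have [rs|sr] := leP r s; last by rewrite set_itv_ge ?measure0// bnd_simp -leNgt ltW.
  have ioc : `]r, s]%classic = `]-oo, s]%classic `\` `]-oo, r]%classic :> set R.
    apply/seteqP; split => x /=; rewrite !in_itv/=.
      by move=> /andP[rx ->]; split => //; apply/negP; rewrite -ltNge.
    by move=> [-> /negP]; rewrite -ltNge andbT.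
  rewrite ioc !measureD//; try (by rewrite ltey_eq fin_num_measure).
  have sub : `]-oo, r]%classic `<=` `]-oo, s]%classic by apply: subset_itvl; rewrite bnd_simp.
  have LA t : L `]-oo, t]%classic = P `]-oo, t]%classic by rewrite LE; exact: law.
  by rewrite (setIidr sub); congr (_ - _); exact: LA.
- by move=> n; rewrite ltey_eq fin_num_measure.
Qed.

End Quantile.

(** * Prolongation of segments in the one-dimensional models *)

Section OneDimensionalModels.
Context {R : realType}.

(** The local geometry of an interval, in a form that isometries transport: a
    short segment from a to b goes on to some c, with b inside, and the segment
    from a to c is a copy of a real interval, its points being told apart by their
    distance to a and its interior being open. Betweenness of x is written
    dA a x + dA x c <= dA a c. *)
Definition locally_prolongable (U : Type) (A : set U) (dA : U -> U -> R) : Prop :=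
  forall a, A a -> exists2 delta : R, 0 < delta &
  forall b, A b -> 0 < dA a b < delta -> exists c,
  [/\ A c, 0 < dA b c, dA a c = dA a b + dA b c,
      forall x x', A x -> A x' -> dA a x + dA x c <= dA a c ->
        dA a x' + dA x' c <= dA a c -> dA a x = dA a x' -> x = x' &
      forall x, A x -> 0 < dA a x -> 0 < dA x c ->
        dA a x + dA x c <= dA a c ->
        exists2 r, 0 < r & forall x', A x' -> dA x x' < r ->
          dA a x' + dA x' c <= dA a c].

Lemma locally_prolongable_isometric (T U : Type) (A : set T) dA (B : set U) dB :
  isometric A dA B dB -> locally_prolongable B dB -> locally_prolongable A dA.
Proof.
move=> [f [fAB finj fsurj] iso] HB a Aa.
have [delta d0 Hd] := HB _ (fAB _ Aa); exists delta => // b Ab.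
rewrite -(iso a b)// => /(Hd _ (fAB _ Ab))[fc [Bfc]].
have [c Ac <-] := fsurj _ Bfc => bc0 add P Q.
exists c; rewrite -!iso//; split=> //.
  move=> x x' Ax Ax'; rewrite -!iso// => xc x'c xx'.
  exact: finj (mem_set Ax) (mem_set Ax') (P _ _ (fAB _ Ax) (fAB _ Ax') xc x'c xx').
move=> x Ax; rewrite -!iso// => ax xc axc.
have [r r0 Hr] := Q _ (fAB _ Ax) ax xc axc; exists r => // x' Ax'.
by rewrite -!iso// => /(Hr _ (fAB _ Ax')).
Qed.

Let itv_of_sum (a c x : R) : a < c -> `|a - x| + `|x - c| <= `|a - c| ->
  a <= x <= c.
Proof.
move=> ac; rewrite (ltr0_norm (_ : a - c < 0)) ?subr_lt0// => H.
have := ler_norm (a - x); have := ler_norm (x - c).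
have := ler_norm (- (a - x)); have := ler_norm (- (x - c)).
by rewrite !normrN => *; apply/andP; lra.
Qed.

Let itv_of_sumV (a c x : R) : c < a -> `|a - x| + `|x - c| <= `|a - c| ->
  c <= x <= a.
Proof.
move=> ca; rewrite addrC (distrC x) (distrC a x) (distrC a c).
exact: itv_of_sum.
Qed.

(** For a subset of the line that contains b and c, points between a and c are
    read off from their coordinate, so that only c has to be found. *)
Lemma locally_prolongable_line (A : set R) :
  (forall a, A a -> exists2 delta, 0 < delta & forall b, A b ->
    0 < `|a - b| < delta -> exists2 c, A c & (a < b < c) || (c < b < a)) ->
  locally_prolongable A line_dist.
Proof.
move=> HA a /HA[delta d0 Hd]; exists delta => // b Ab /Hd -/(_ Ab)[c Ac abc].
exists c; rewrite /line_dist; split => //.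
- by rewrite normr_gt0 subr_eq0; apply/eqP => bc; move: abc; rewrite bc; lra.
- case/orP: abc => /andP[ab bc].
    by rewrite !ltr0_norm ?subr_lt0//; [lra|exact: lt_trans ab bc].
  by rewrite !gtr0_norm ?subr_gt0//; [lra|exact: lt_trans ab bc].
- move=> x x' _ _; case/orP: abc => /andP[ab bc].
    have ac := lt_trans ab bc.
    move=> /(itv_of_sum ac)/andP[ax _] /(itv_of_sum ac)/andP[ax' _].
    by rewrite !ler0_norm ?subr_le0//; lra.
  have ca := lt_trans ab bc.
  move=> /(itv_of_sumV ca)/andP[_ xa] /(itv_of_sumV ca)/andP[_ x'a].
  by rewrite !ger0_norm ?subr_ge0//; lra.
- move=> x _ ax xc H; exists (Num.min `|a - x| `|x - c|); first by rewrite lt_min ax xc.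
  move=> x' _; rewrite lt_min => /andP[h1 h2]; case/orP: abc => /andP[ab bc].
    have ac := lt_trans ab bc; have /andP[ax' xc'] := itv_of_sum ac H.
    move: h1 h2; rewrite (ler0_norm (_ : a - x <= 0)) ?subr_le0//.
    rewrite (ler0_norm (_ : x - c <= 0)) ?subr_le0// !ltr_norml.
    move=> /andP[h1 h2] /andP[h3 h4]; rewrite (ltr0_norm (_ : a - x' < 0)); last lra.
    by rewrite (ltr0_norm (_ : x' - c < 0)) ?(ltr0_norm (_ : a - c < 0)); lra.
  have ca := lt_trans ab bc; have /andP[ax' xc'] := itv_of_sumV ca H.
  move: h1 h2; rewrite (ger0_norm (_ : 0 <= a - x)) ?subr_ge0//.
  rewrite (ger0_norm (_ : 0 <= x - c)) ?subr_ge0// !ltr_norml.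
  move=> /andP[h1 h2] /andP[h3 h4]; rewrite (gtr0_norm (_ : 0 < a - x')); last lra.
  by rewrite (gtr0_norm (_ : 0 < x' - c)) ?(gtr0_norm (_ : 0 < a - c)); lra.
Qed.

Lemma locally_prolongable_R : locally_prolongable [set: R] line_dist.
Proof.
apply: locally_prolongable_line => a _; exists 1 => // b _ /andP[+ _].
rewrite normr_gt0 subr_eq0 neq_lt => /orP[ab|ba].
  by exists (b + 1) => //; rewrite ab ltrDl ltr01.
by exists (b - 1) => //; rewrite ba gtrBl ltr01 orbT.
Qed.

Lemma locally_prolongable_halfline : locally_prolongable `[0, +oo[ (@line_dist R).
Proof.
apply: locally_prolongable_line => a; rewrite /= in_itv/= andbT => a0.
exists (if a == 0 then 1 else a); first by case: eqVneq => // an0; lra.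
move=> b; rewrite /= in_itv/= andbT => b0 /andP[].
rewrite normr_gt0 subr_eq0 neq_lt => /orP[ab|ba] ad.
  by exists (b + 1); rewrite /= ?in_itv/= ?andbT; lra.
have bp : 0 < b.
  by move: ad; rewrite gtr0_norm ?subr_gt0//; case: eqVneq => [a00|_]; lra.
by exists (b / 2); rewrite /= ?in_itv/= ?andbT; lra.
Qed.

Lemma locally_prolongable_segment : locally_prolongable `[-1, 1] (@line_dist R).
Proof.
apply: locally_prolongable_line => a; rewrite /= in_itv/= => a1.
have [am|am] := eqVneq a (-1).
  exists 1 => // b; rewrite /= in_itv/= => b1 /andP[].
  have [ba|ba] := ler0P (a - b) => h1 h2; last by lra.
  by exists ((b + 1) / 2); rewrite /= ?in_itv/=; lra.
have [ap|ap] := eqVneq a 1.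
  exists 1 => // b; rewrite /= in_itv/= => b1 /andP[].
  have [ba|ba] := ler0P (a - b) => h1 h2; first by lra.
  by exists ((b - 1) / 2); rewrite /= ?in_itv/=; lra.
have aint : -1 < a < 1.
  by case/andP: a1 => a1 a1'; rewrite !lt_neqAle a1 a1' ap eq_sym am.
exists (Num.min (1 - a) (1 + a)); first by rewrite lt_min; lra.
move=> b; rewrite /= in_itv/= => b1 /andP[]; rewrite lt_min.
have [ba|ba] := ler0P (a - b) => h0 /andP[h1 h2].
  by exists ((b + 1) / 2); rewrite /= ?in_itv/=; lra.
by exists ((b - 1) / 2); rewrite /= ?in_itv/=; lra.
Qed.

Let dot (p q : R * R) : R := p.1 * q.1 + p.2 * q.2.

Let arcE p q : arc_dist p q = acos (dot p q). Proof. by []. Qed.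

Let dot_bnd p q : circle p -> circle q -> -1 <= dot p q <= 1.
Proof.
rewrite /circle /dot /= => hp hq.
have h1 : 0 <= (p.1 - q.1) ^+ 2 + (p.2 - q.2) ^+ 2 by rewrite addr_ge0 ?sqr_ge0.
have h2 : 0 <= (p.1 + q.1) ^+ 2 + (p.2 + q.2) ^+ 2 by rewrite addr_ge0 ?sqr_ge0.
by apply/andP; split; nra.
Qed.

Let arc_bnd p q : circle p -> circle q -> 0 <= arc_dist p q <= @pi R.
Proof. by move=> cp cq; rewrite acos_ge0 ?acos_lepi ?dot_bnd. Qed.

Let cos_arc p q : circle p -> circle q -> cos (arc_dist p q) = dot p q.
Proof. by move=> cp cq; rewrite acosK// in_itv/= dot_bnd. Qed.

Let arc_cos p q t : 0 <= t <= @pi R -> dot p q = cos t -> arc_dist p q = t.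
Proof. by move=> t0 E; rewrite arcE E cosK// in_itv. Qed.

Let cos_le (s t : R) : 0 <= s <= @pi R -> 0 <= t <= @pi R -> s <= t -> cos t <= cos s.
Proof.
move=> hs ht; rewrite le_eqVlt => /predU1P[->//|st]; apply: ltW.
by rewrite ltr_cos// in_itv.
Qed.

(** Angles from a on the side of b play the part of a coordinate: in the frame
    a, n with n orthogonal to a and on the side of b, the points of the arc from
    a to c = 2 beta are those with nonnegative second coordinate. *)
Lemma locally_prolongable_circle : locally_prolongable circle (@arc_dist R).
Proof.
move=> a ca; exists (@pi R / 2); first by rewrite divr_gt0 ?pi_gt0.
move=> b cb; set beta := arc_dist a b => /andP[beta0 betapi].
have ub : dot a b = cos beta by rewrite cos_arc.
have pi0 := @pi_gt0 R.
have sb0 : 0 < sin beta by rewrite sin_gt0_pi// beta0/=; lra.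
have s2b0 : 0 < sin (beta *+ 2) by rewrite sin_gt0_pi//; apply/andP; lra.
have a1 : a.1 ^+ 2 + a.2 ^+ 2 = 1 := ca.
have b1 : b.1 ^+ 2 + b.2 ^+ 2 = 1 := cb.
(* n is a quarter turn of a, one way or the other *)
have [n [nb frame]] : exists n : R * R, dot n b = sin beta /\
    forall x y, dot x y = dot a x * dot a y + dot n x * dot n y.
  have frm e x y : e ^+ 2 = 1 -> dot x y = dot a x * dot a y +
      dot (- (e * a.2), e * a.1) x * dot (- (e * a.2), e * a.1) y.
    rewrite /dot /= => e1.
    have -> : x.1 * y.1 + x.2 * y.2 =
        (a.1 ^+ 2 + a.2 ^+ 2) * (x.1 * y.1 + x.2 * y.2) by rewrite a1 mul1r.
    have -> : (- (e * a.2) * x.1 + e * a.1 * x.2) *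
        (- (e * a.2) * y.1 + e * a.1 * y.2) =
        e ^+ 2 * ((a.1 * x.2 - a.2 * x.1) * (a.1 * y.2 - a.2 * y.1)) by ring.
    by rewrite e1; ring.
  have H : (a.1 * b.2 - a.2 * b.1) ^+ 2 = sin beta ^+ 2.
    rewrite sin2cos2 -ub /dot.
    have -> : 1 = (a.1 ^+ 2 + a.2 ^+ 2) * (b.1 ^+ 2 + b.2 ^+ 2) :> R.
      by rewrite a1 b1 mulr1.
    by ring.
  move/eqP: H; rewrite eqf_sqr => /orP[/eqP H|/eqP H].
    exists (- (1 * a.2), 1 * a.1); split; first by rewrite /dot /= -H; ring.
    by move=> x y; apply: frm; rewrite expr1n.
  exists (- (-1 * a.2), -1 * a.1); split.
    by rewrite /dot /= -[RHS]opprK -H; ring.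
  by move=> x y; apply: frm; rewrite sqrrN expr1n.
have unit x : circle x -> dot a x ^+ 2 + dot n x ^+ 2 = 1.
  move=> cx; have <- : dot x x = 1 by rewrite /dot -!expr2.
  by rewrite (frame x x) !expr2.
pose c : R * R := (2 * cos beta * b.1 - a.1, 2 * cos beta * b.2 - a.2).
have na : dot n a = 0.
  have := unit a ca; have -> : dot a a = 1 by rewrite /dot -!expr2.
  by rewrite expr1n => H; apply/eqP; rewrite -sqrf_eq0; apply/eqP; lra.
have ac : dot a c = cos (beta *+ 2).
  have -> : dot a c = 2 * cos beta * dot a b - (a.1 ^+ 2 + a.2 ^+ 2).
    by rewrite /c /dot /=; ring.
  by rewrite ub a1 cos_mulr2n; ring.
have nc : dot n c = sin (beta *+ 2).
  have -> : dot n c = 2 * cos beta * dot n b - dot n a.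
    by rewrite /c /dot /=; ring.
  by rewrite nb na sin_mulr2n; ring.
have cc : circle c.
  rewrite /circle /= -[LHS]/(c.1 ^+ 2 + c.2 ^+ 2) !expr2 -[LHS]/(dot c c).
  by rewrite frame ac nc -!expr2 cos2Dsin2.
have dac : arc_dist a c = beta *+ 2 by apply: arc_cos => //; lra.
have dbc : arc_dist b c = beta.
  apply: arc_cos; first lra.
  have -> : dot b c = 2 * cos beta * (b.1 ^+ 2 + b.2 ^+ 2) - dot a b.
    by rewrite /c /dot /=; ring.
  by rewrite b1 ub; ring.
have xcE x : circle x ->
    dot x c = cos (arc_dist a x) * cos (beta *+ 2) + dot n x * sin (beta *+ 2).
  by move=> cx; rewrite (frame x c) ac nc cos_arc.
have nsin x : circle x -> dot n x ^+ 2 = sin (arc_dist a x) ^+ 2.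
  by move=> cx; have := unit x cx; rewrite sin2cos2 cos_arc//; lra.
have sin0 x : circle x -> 0 <= sin (arc_dist a x).
  by move=> cx; apply: sin_ge0_pi; exact: arc_bnd.
have sqr_inj (u v : R) : 0 <= u -> 0 <= v -> u ^+ 2 = v ^+ 2 -> u = v.
  by move=> u0 v0 /eqP; rewrite eqrXn2// => /eqP.
have btw x : circle x -> arc_dist a x + arc_dist x c <= arc_dist a c ->
    dot n x = sin (arc_dist a x).
  move=> cx; rewrite dac => H.
  have /andP[ax0 axp] := arc_bnd ca cx; have /andP[xc0 xcp] := arc_bnd cx cc.
  have : cos (beta *+ 2 - arc_dist a x) <= cos (arc_dist x c).
    by apply: cos_le; lra.
  rewrite cos_arc// (xcE x cx) cosB => H2.
  have H3 : sin (arc_dist a x) * sin (beta *+ 2) <= dot n x * sin (beta *+ 2) by lra.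
  move: H3; rewrite ler_pM2r// => H3.
  by apply: sqr_inj; [exact: le_trans (sin0 x cx) H3|exact: sin0|exact: nsin].
have btwC x : circle x -> 0 <= dot n x -> arc_dist a x <= beta *+ 2 ->
    arc_dist a x + arc_dist x c <= arc_dist a c.
  move=> cx nx axb; rewrite dac.
  have nxE : dot n x = sin (arc_dist a x).
    by apply: sqr_inj; [|exact: sin0|exact: nsin].
  have /andP[ax0 axp] := arc_bnd ca cx.
  have -> : arc_dist x c = beta *+ 2 - arc_dist a x; last by lra.
  by apply: arc_cos; [lra|rewrite xcE// nxE cosB; ring].
exists c; split => //; first by rewrite dbc.
- by rewrite dac dbc mulr2n.
- move=> x x' cx cx' /(btw x cx) nx /(btw x' cx') nx' xx'.
  have ax : dot a x = dot a x' by rewrite -!cos_arc// xx'.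
  have nxx : dot n x = dot n x' by rewrite nx nx' xx'.
  have yx y : dot y x = dot y x' by rewrite (frame y x) ax nxx -frame.
  have := yx (1, 0); have := yx (0, 1); rewrite /dot /=.
  by case: (x) (x') => [? ?] [? ?] /=; rewrite !mul0r !mul1r ?add0r ?addr0 => -> ->.
move=> x cx ax0 xc0 axc; have nx := btw x cx axc; rewrite dac in axc.
have /andP[_ axp] := arc_bnd ca cx.
have nx0 : 0 < dot n x by rewrite nx sin_gt0_pi//; lra.
have gap : 0 < dot a x - cos (beta *+ 2).
  by rewrite -cos_arc// subr_gt0 ltr_cos ?in_itv/=; lra.
pose m := Num.min (dot n x) (dot a x - cos (beta *+ 2)).
have m0 : 0 < m by rewrite lt_min nx0.
have m1 : m <= 1.
  apply: le_trans (_ : dot n x <= 1); first by rewrite ge_min lexx.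
  by rewrite nx sin_le1.
have m2 : m ^+ 2 <= 1 by rewrite expr_le1// ltW.
have m20 : 0 < m ^+ 2 by rewrite exprn_gt0.
exists (acos (1 - m ^+ 2 / 2)); first by apply: acos_gt0; lra.
move=> x' cx' xx'.
have close : 1 - m ^+ 2 / 2 < dot x x'.
  rewrite -cos_arc// -[ltLHS]acosK ?in_itv/=; last by lra.
  rewrite ltr_cos// in_itv/= ?arc_bnd// acos_ge0 ?acos_lepi//; lra.
have chord : (dot a x - dot a x') ^+ 2 + (dot n x - dot n x') ^+ 2 < m ^+ 2.
  have := unit x cx; have := unit x' cx'; rewrite frame in close; nra.
have near1 (t : R) : t ^+ 2 < m ^+ 2 -> t < m.
  by move=> tm; rewrite ltNge; apply/negP => mt; nra.
have an : dot a x - dot a x' < m.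
  by apply: near1; apply: le_lt_trans chord; rewrite lerDl sqr_ge0.
have nn : dot n x - dot n x' < m.
  by apply: near1; apply: le_lt_trans chord; rewrite lerDr sqr_ge0.
move: an nn; rewrite !lt_min => /andP[_ an] /andP[nn _].
apply: btwC => //; first by lra.
have /andP[ax'0 ax'p] := arc_bnd ca cx'.
rewrite leNgt; apply/negP => H.
have : cos (arc_dist a x') <= cos (beta *+ 2) by apply: cos_le; lra.
by rewrite cos_arc//; lra.
Qed.

Lemma locally_prolongable_models (U : Type) (A : set U) (dA : U -> U -> R) :
  [\/ isometric A dA `[-1, 1] line_dist, isometric A dA `[0, +oo[ line_dist,
      isometric A dA [set: R] line_dist | isometric A dA circle arc_dist] ->
  locally_prolongable A dA.
Proof.
case=> /locally_prolongable_isometric; apply.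
- exact: locally_prolongable_segment.
- exact: locally_prolongable_halfline.
- exact: locally_prolongable_R.
- exact: locally_prolongable_circle.
Qed.

End OneDimensionalModels.

(** * Distance to an orbit, and slices *)

Lemma mdist_lipschitz (R : realType) (X : completeMetricType R) (x y z : X) :
  `|mdist x z - mdist y z| <= mdist x y.
Proof.
have := metric_triangle x y z; have := metric_triangle y x z.
by rewrite (metric_sym y x) ler_norml => ? ?; apply/andP; lra.
Qed.

Lemma lipschitz_continuous (R : realType) (X : completeMetricType R) (f : X -> R) :
  (forall x y, `|f x - f y| <= mdist x y) -> continuous f.
Proof.
move=> lipf x; apply/cvgrPdist_lt => e e0.
have : nbhs x (ball x e) by exact: nbhsx_ballx.
apply: filterS => y; rewrite ballEmdist /= => xy.
exact: le_lt_trans (lipf x y) xy.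
Qed.

Section OrbitDistance.
Context {R : realType} {X : completeMetricType R} {G : topologicalGroupType}.
Variable act : G -> X -> X.
Hypothesis cptG : compact [set: G].
Hypothesis cact : continuous_action act.
Hypothesis iact : isometric_action act.

Definition orbit_dist (x y : X) : R := set_dist (act_orbit act x) [set y].

Let act1 x : act 1%g x = x. Proof. by case: cact. Qed.
Let actM g h x : act (g * h)%g x = act g (act h x). Proof. by case: cact. Qed.

Lemma actK g : cancel (act g) (act g^-1%g).
Proof. by move=> x; rewrite -actM mulVg act1. Qed.

Lemma actVK g : cancel (act g^-1%g) (act g).
Proof. by move=> x; rewrite -actM mulgV act1. Qed.

Lemma act_continuous_pair : continuous (fun p : G * X => act p.1 p.2).
Proof. by case: cact. Qed.

Lemma act_orbit_continuous x : continuous (fun g => act g x).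
Proof.
move=> g; have pc : (fun h : G => (h, x)) @ g --> (g, x).
  by apply: (@cvg_pair _ _ _ (nbhs g) (nbhs g) (nbhs x)); [exact: cvg_id|exact: cvg_cst].
exact: cvg_comp pc (@act_continuous_pair (g, x)).
Qed.

Let has_inf_dist (x y : X) :
  has_inf [set r | exists a b, [/\ act_orbit act x a, [set y] b & r = mdist a b]].
Proof.
split; first by exists (mdist x y), x, y; split => //; exists 1%g; rewrite ?act1.
by exists 0 => _ [a [b [_ _ ->]]]; exact: mdist_ge0.
Qed.

Lemma orbit_dist_le g x y : orbit_dist x y <= mdist (act g x) y.
Proof.
apply: ge_inf; first by case: (has_inf_dist x y).
by exists (act g x), y; split => //; exists g.
Qed.

Lemma orbit_dist_attained x y : exists g, mdist (act g x) y = orbit_dist x y.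
Proof.
have [||g _ gmin] := @compact_EVT_min G R (fun g => mdist (act g x) y) setT _ cptG.
- by exists 1%g.
- apply: continuous_subspaceT => g.
  have cy : continuous (fun z => mdist z y).
    by apply: lipschitz_continuous => a b; exact: mdist_lipschitz.
  exact: cvg_comp (@act_orbit_continuous x g) (cy _).
exists g; apply/eqP; rewrite eq_le orbit_dist_le andbT.
apply: lb_le_inf; first by case: (has_inf_dist x y).
by move=> _ [_ [_ [[h _ <-] -> ->]]]; apply: gmin; rewrite inE.
Qed.

Lemma orbit_dist_act g h x y : orbit_dist (act g x) (act h y) = orbit_dist x y.
Proof.
apply/eqP; rewrite eq_le; apply/andP; split.
  have [k <-] := orbit_dist_attained x y.
  apply: le_trans (orbit_dist_le (h * k * g^-1)%g _ _) _.
  by rewrite !actM actK iact.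
have [k <-] := orbit_dist_attained (act g x) (act h y).
apply: le_trans (orbit_dist_le (h^-1 * k * g)%g _ _) _.
by rewrite -(iact h) !actM actVK.
Qed.

Lemma orbit_dist_ge0 x y : 0 <= orbit_dist x y.
Proof. by have [g <-] := orbit_dist_attained x y; exact: mdist_ge0. Qed.

Lemma orbit_dist_mdist x y : orbit_dist x y <= mdist x y.
Proof. by have := orbit_dist_le 1%g x y; rewrite act1. Qed.

Lemma orbit_dist_sym x y : orbit_dist x y = orbit_dist y x.
Proof.
suff H a b : orbit_dist a b <= orbit_dist b a by apply/eqP; rewrite eq_le !H.
have [g <-] := orbit_dist_attained b a.
apply: le_trans (orbit_dist_le g^-1%g _ _) _.
by rewrite -(iact g) actVK metric_sym.
Qed.

Lemma orbit_dist_triangle y x z : orbit_dist x z <= orbit_dist x y + orbit_dist y z.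
Proof.
have [g <-] := orbit_dist_attained x y; have [h <-] := orbit_dist_attained y z.
apply: le_trans (orbit_dist_le (h * g)%g _ _) _.
by apply: le_trans (metric_triangle _ (act h y) _) _; rewrite actM iact.
Qed.

Lemma orbit_dist_lipschitz x y z : `|orbit_dist x y - orbit_dist x z| <= mdist y z.
Proof.
have h1 := orbit_dist_triangle y x z; have h2 := orbit_dist_triangle z x y.
have := orbit_dist_mdist y z; rewrite ler_norml; move: h2.
by rewrite (orbit_dist_sym z y) => ? ?; apply/andP; lra.
Qed.

Lemma orbit_dist_continuous x : continuous (orbit_dist x).
Proof. by apply: lipschitz_continuous => y z; exact: orbit_dist_lipschitz. Qed.

Lemma act_orbit_act g x : act_orbit act (act g x) = act_orbit act x.
Proof.
apply/seteqP; split => _ [h _ <-]; first by exists (h * g)%g; rewrite ?actM.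
by exists (h * g^-1)%g => //; rewrite actM actK.
Qed.

Lemma set_dist_orbits x y :
  set_dist (act_orbit act x) (act_orbit act y) = orbit_dist x y.
Proof.
apply/eqP; rewrite eq_le; apply/andP; split.
  have [g <-] := orbit_dist_attained x y; apply: ge_inf.
    by exists 0 => _ [a [b [_ _ ->]]]; exact: mdist_ge0.
  by exists (act g x), y; split; [exists g|exists 1%g|].
apply: lb_le_inf.
  by exists (mdist x y), x, y; split => //; exists 1%g; rewrite ?act1.
move=> _ [_ [_ [[g _ <-] [h _ <-] ->]]].
rewrite -(orbit_dist_act g h); exact: orbit_dist_mdist.
Qed.

(** All conditions on a slice but the last are formal; the last one says that a
    point near the orbit of x has at most one nearest point on that orbit. *)
Lemma slice_of_unique_foot (x : X) (delta : R) : 0 < delta ->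
  (forall y g, orbit_dist x y < delta -> mdist x y = orbit_dist x y ->
     mdist (act g x) y = orbit_dist x y -> act g x = x) ->
  is_slice act x ([set y | mdist x y = set_dist (act_orbit act x) [set y]]
                  `&` ball x delta).
Proof.
move=> d0 uniq.
set S := _ `&` _.
have SE y : S y <-> mdist x y = orbit_dist x y /\ orbit_dist x y < delta.
  rewrite /S ballEmdist /= -/(orbit_dist x y).
  by split=> -[xy]; rewrite xy => ?; split.
have GS : saturation act setT S = [set y | orbit_dist x y < delta].
  apply/seteqP; split => y.
    by move=> [g _ [z /SE[_ zd] <-]] /=; rewrite -(orbit_dist_act 1%g g) act1 in zd.
  move=> yd; have [g gy] := orbit_dist_attained x y.
  exists g => //; exists (act g^-1%g y); last exact: actVK.
  rewrite SE -(orbit_dist_act 1%g g) act1 actVK; split => //.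
  by rewrite -gy -(iact g) actVK.
have dxx : orbit_dist x x = 0.
  by apply/eqP; rewrite eq_le orbit_dist_ge0 -(mdistxx x) orbit_dist_mdist.
split; first by rewrite SE mdistxx dxx.
split.
- exists [set y | mdist x y - orbit_dist x y = 0].
    apply: (@closed_comp _ _ (fun y => mdist x y - orbit_dist x y) [set 0]).
      move=> y _; apply: cvgB; last exact: orbit_dist_continuous.
      apply: lipschitz_continuous => a b.
      by rewrite (metric_sym x a) (metric_sym x b); exact: mdist_lipschitz.
    exact: closed_eq.
  rewrite GS; apply/seteqP; split => y /=.
    by rewrite SE => -[-> yd]; split; rewrite ?subrr.
  by move=> [/eqP]; rewrite subr_eq0 => /eqP xy yd; rewrite SE.
- rewrite GS; split.
    apply: (@open_comp _ _ (orbit_dist x) [set r | r < delta]).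
      by move=> y _; exact: orbit_dist_continuous.
    exact: open_lt.
  by move=> _ [g _ <-] /=; rewrite -[X in orbit_dist X]act1 orbit_dist_act dxx.
- apply/seteqP; split => y; last by move=> Sy; exists 1%g; [exact: act1|exists y].
  move=> [g gx [z /SE[xz zd] <-]]; rewrite SE.
  rewrite -[X in orbit_dist X](act1 x) orbit_dist_act; split => //.
  by rewrite -[X in mdist X]gx iact.
- move=> g [_ [[z /SE[xz zd] <-] /SE[xgz _]]].
  move: xgz; rewrite -[X in orbit_dist X](act1 x) orbit_dist_act => xgz.
  have := uniq z g^-1%g zd xz; rewrite -(iact g) actVK => /(_ xgz) gx.
  by rewrite /isotropy /= -{1}gx actVK.
Qed.

End OrbitDistance.

(** * Invariant probabilities on compact groups *)

Section ProbabilityOfMeasure.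
Context d (T : measurableType d) (R : realType).
Variables (m : {measure set T -> \bar R}) (mT : m setT = 1%E).

(** A copy of m carrying the proof that its mass is 1, on which the structure of
    probability can be declared. *)
Definition unit_mass_measure of m setT = 1%E : set T -> \bar R := m.

HB.instance Definition _ := Measure.on (unit_mass_measure mT).

HB.instance Definition _ :=
  Measure_isProbability.Build _ _ _ (unit_mass_measure mT) mT.

Lemma probability_of_measure :
  exists P : probability T R, P = m :> (set T -> \bar R).
Proof. by exists (unit_mass_measure mT). Qed.

End ProbabilityOfMeasure.

(** Right translations are isometries of D. The sigma-algebra is that of the
    Carathéodory measurable sets, not of the Borel sets of G, hence the separate
    space Om. *)
Theorem invariant_probability (R : realType) (G : topologicalGroupType)
    (D : G -> G -> R) :
  compact [set: G] ->
  (forall g, D g g = 0) -> (forall g h, D g h = D h g) ->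
  (forall h g k, D g k <= D g h + D h k) ->
  (forall g e, 0 < e -> nbhs g [set h | D g h < e]) ->
  (forall k g h, D (g * k)%g (h * k)%g = D g h) ->
  exists d (Om : measurableType d) (P : probability Om R) (io : Om -> G),
  [/\ forall g e, measurable [set w | D g (io w) < e] &
      forall k (A : set G), P [set w | A (io w * k)%g] = P [set w | A (io w)]].
Proof.
move=> cptG Dxx Dsym Dtri Dnbhs Dinv.
pose TG : ptopologicalType :=
  HB.pack (G : Type) (Topological.on G) (isPointed.Build G 1%g).
have cptTG : cover_compact [set: G].
  by have : @compact TG [set: G] := cptG; rewrite compact_cover.
pose T : pointedType := HB.pack (G : Type) (Choice.on G) (isPointed.Build G 1%g).
have dopen (V : set G) : @dist_open R T D V -> open V.
  move=> oV; rewrite openE => g Vg; have [e e0 eV] := oV g Vg.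
  by apply: filterS (Dnbhs g e e0) => h /eV.
have oball g e : open [set h | D g h < e].
  apply: dopen => h /= gh; exists (e - D g h); first by rewrite subr_gt0.
  by move=> k hk; have := Dtri h g k; rewrite /=; lra.
have [||mu [muT muinv mucar]] :=
    @isometry_invariant_outer_measure R T D Dxx Dsym Dtri.
- move=> e e0; have := cptTG.
  move=> /(_ G setT (fun g => [set h | D g h < e]) (fun g _ => oball g e)).
  case; first by move=> g _; exists g => //=; rewrite Dxx.
  move=> s _ sG; exists (finmap.enum_fset s) => y _.
  by have [x xs xy] := sG y I; exists x.
- move=> F oF coverF; have := cptTG.
  move=> /(_ nat setT F (fun n _ => dopen _ (oF n))).
  case; first by move=> g _; have [n Fn] := coverF g; exists n.
  move=> s _ sG; exists (\max_(i <- finmap.enum_fset s) i).+1 => y.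
  have [i is_ Fi] := sG y I; exists i => //.
  by rewrite ltnS; apply: (@leq_bigmax_seq _ (finmap.enum_fset s) xpredT (fun i => i)).
pose Om := caratheodory_type mu.
have [P PE] := @probability_of_measure _ Om R mu muT.
exists _, Om, P, (fun w => w); split => [g e|k A]; first exact: mucar.
rewrite PE; apply: (muinv (fun g : G => g * k)%g (fun g : G => g * k^-1)%g A).
- by move=> g; rewrite -mulgA mulgV mulg1.
- by move=> g; rewrite -mulgA mulVg mulg1.
- by move=> g h; exact: Dinv.
Qed.

(** * Measurability of sets that are open in two variables *)

Section Resolvable.
Context {R : realType}.

(** A second countability condition that does not refer to a topology on T, only to
    its measurable sets and to a distance; it suffices for product
    sigma-algebras to contain the sets that are open in two variables. *)
Definition resolvable d (T : measurableType d) (K : set T) (dT : T -> T -> R) :=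
  exists (I : countType) (A : nat -> I -> set T),
  [/\ forall n i, measurable (A n i), forall n p, K p -> exists i, A n i p,
      forall n i, A n i `<=` K &
      forall n i p q, A n i p -> A n i q -> dT p q < n.+1%:R^-1].

Lemma measurable_bigcup_countType d (T : measurableType d) (I : countType)
    (P : set I) (F : I -> set T) : (forall i, measurable (F i)) ->
  measurable (\bigcup_(i in P) F i).
Proof.
move=> mF; pose F' n := if unpickle n is Some i then
  [set x | P i /\ F i x] else set0.
rewrite (_ : \bigcup_(i in P) _ = \bigcup_n F' n).
  apply: bigcupT_measurable => n; rewrite /F'; case: unpickle => [i|//].
  have [Pi|nPi] := pselect (P i).
    by rewrite (_ : [set x | _] = F i)//; apply/seteqP; split => x //= [].
  by rewrite (_ : [set x | _] = set0)//; apply/seteqP; split => x //= [].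
apply/seteqP; split => x.
  by move=> [i Pi Fi]; exists (pickle i) => //; rewrite /F' pickleK.
by move=> [n _]; rewrite /F'; case: unpickle => // i [Pi Fi]; exists i.
Qed.

(** Such a set is a countable union of measurable rectangles; the Borel sets of
    the product topology need not belong to the product sigma-algebra. *)
Lemma measurable_resolvable d1 (T1 : measurableType d1) (K1 : set T1) (D1 : T1 -> T1 -> R)
    d2 (T2 : measurableType d2) (K2 : set T2) (D2 : T2 -> T2 -> R)
    (O : set (T1 * T2)) :
  resolvable K1 D1 -> resolvable K2 D2 ->
  O `<=` K1 `*` K2 ->
  (forall p q, O (p, q) -> exists2 e, 0 < e & forall p' q', K1 p' -> K2 q' ->
    D1 p p' < e -> D2 q q' < e -> O (p', q')) ->
  measurable O.
Proof.
move=> [I1 [A1 [mA1 covA1 subA1 diamA1]]] [I2 [A2 [mA2 covA2 subA2 diamA2]]] OK oO.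
pose rect (t : nat * (I1 * I2)) := A1 t.1 t.2.1 `*` A2 t.1 t.2.2.
have -> : O = \bigcup_(t in [set t | rect t `<=` O]) rect t.
  apply/seteqP; split => [[p q] Opq|x [t /= sub /sub]//].
  have [K1p K2q] := OK _ Opq; have [e e0 He] := oO p q Opq.
  have [n _ /(_ n (leqnn n)) ne] := near_infty_natSinv_lt (PosNum e0).
  have [i Ai] := covA1 n p K1p; have [j Aj] := covA2 n q K2q.
  exists (n, (i, j)) => // -[p' q'] [/= Aip' Ajq'].
  apply: He; [exact: subA1 Aip'|exact: subA2 Ajq'| |].
    by apply: lt_trans ne; exact: diamA1 Ai Aip'.
  by apply: lt_trans ne; exact: diamA2 Aj Ajq'.
by apply: measurable_bigcup_countType => t; exact: measurableX.
Qed.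

Lemma measurable_open (X : ptopologicalType) (U : set X) :
  open U -> measurable (U : set (borel X)).
Proof. exact: sub_sigma_algebra. Qed.

Lemma measurable_closed (X : ptopologicalType) (F : set X) :
  closed F -> measurable (F : set (borel X)).
Proof.
move=> cF; rewrite -[X in measurable X]setCK; apply: measurableC.
by apply: measurable_open; exact: closed_openC.
Qed.

(** Balls with centers in a countable dense set. *)
Lemma resolvable_separable (X : completeMetricType R) (K : set (borel X)) :
  separable X -> measurable K ->
  resolvable K (fun x y : borel X => mdist (x : X) (y : X)).
Proof.
move=> [Q /countable_injP[f Qinj] dQ] mK.
pose B n k : set X := [set y | exists q, [/\ Q q, f q = k & mdist q y < (n.+1%:R^-1 / 2)]].
have r0 n : 0 < n.+1%:R^-1 / 2 :> R by rewrite divr_gt0.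
exists nat, (fun n k => B n k `&` K); split.
- move=> n k; apply: measurableI => //; apply: measurable_open.
  rewrite openE => y [q [Qq fq qy]].
  have e0 : 0 < n.+1%:R^-1 / 2 - mdist q y by rewrite subr_gt0.
  apply: filterS (nbhsx_ballx y _ e0) => z; rewrite ballEmdist /= => yz.
  exists q; split => //; apply: le_lt_trans (metric_triangle q y z) _.
  by rewrite -ltrBrDl.
- move=> n p Kp.
  have bo : open (ball (p : X) (n.+1%:R^-1 / 2)).
    rewrite ballEmdist.
    apply: (@open_comp _ _ (mdist (p : X)) [set r | r < n.+1%:R^-1 / 2]); last exact: open_lt.
    move=> z _; apply: lipschitz_continuous => a b.
    by rewrite !(metric_sym (p : X)); exact: mdist_lipschitz.
  have bp : ball (p : X) (n.+1%:R^-1 / 2) !=set0.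
    by exists (p : X); rewrite ballEmdist /= mdistxx.
  have [y [py Qy]] := dQ _ bp bo.
  exists (f y); split => //; exists y; split => //.
  by move: py; rewrite ballEmdist metric_sym.
- by move=> n i x [].
- move=> n k p q [[a [Qa fa ap]] _] [[b [Qb fb bq]] _].
  have ab : a = b by apply: Qinj; rewrite ?inE// fa fb.
  subst b; apply: le_lt_trans (metric_triangle (p : X) a (q : X)) _.
  by rewrite (metric_sym (p : X) a) [ltRHS]splitr; exact: ltrD.
Qed.

(** Preimages of small squares with rational centers. *)
Lemma resolvable_pair d (T : measurableType d) (s t : T -> R) :
  measurable_fun setT s -> measurable_fun setT t ->
  resolvable setT (fun u v => Num.max `|s u - s v| `|t u - t v|).
Proof.
move=> ms mt.
pose r n : R := n.+1%:R^-1 / 2.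
have r0 n : 0 < r n by rewrite divr_gt0.
pose B n (k : rat * rat) := [set u | `|s u - ratr k.1| < r n] `&` [set u | `|t u - ratr k.2| < r n].
have near_rat n (x : R) : exists k : rat, `|x - ratr k| < r n.
  have xr : x - r n < x + r n by have := r0 n; lra.
  have [k] := rat_in_itvoo xr.
  by rewrite in_itv/= => kx; exists k; rewrite distrC ltr_distl.
exists (rat * rat)%type, B; split => //.
- move=> n k; apply: measurableI; apply: measurable_set_lt => //;
    apply: measurableT_comp => //; exact: measurable_funB.
- move=> n u _; have [a ha] := near_rat n (s u); have [b hb] := near_rat n (t u).
  by exists (a, b).
- move=> n k p q [/= h1 h2] [/= h3 h4].
  have -> : n.+1%:R^-1 = r n + r n by rewrite /r -splitr.
  move: h1 h2 h3 h4; rewrite gt_max !ltr_norml; move: (r n) => e.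
  move=> /andP[? ?] /andP[? ?] /andP[? ?] /andP[? ?].
  by apply/andP; split; apply/andP; lra.
Qed.

Lemma measurable_fun_open d (T : measurableType d) (X : ptopologicalType)
    (f : T -> X) : (forall U : set X, open U -> measurable (f @^-1` U)) ->
  measurable_fun setT (f : T -> borel X).
Proof.
move=> mf; apply: (@measurability _ _ T (borel X) setT f (@open X)) => [//|_ [U oU <-]].
by rewrite setTI; exact: mf.
Qed.

Lemma measurable_fun_continuous (X : completeMetricType R) (f : X -> R) :
  continuous f -> measurable_fun setT (f : borel X -> R).
Proof.
move=> cf; apply: (measurability _ (RGenOpens.measurableE R)) => _ [_ [a [b ->]] <-].
rewrite setTI; apply: measurable_open.
by apply: (@open_comp _ _ f); [move=> x _; exact: cf|exact: itv_open].
Qed.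

End Resolvable.

(** * Shortest paths between two orbits *)

Section Clamp.
Context {R : realType}.
Implicit Types l r : R.

Definition clamp l r : R := Num.max 0 (Num.min r l).

Lemma clamp_itv l r : 0 <= l -> 0 <= clamp l r <= l.
Proof. by move=> l0; rewrite le_max lexx /= ge_max l0 ge_min lexx orbT. Qed.

Lemma clamp_id l r : 0 <= r <= l -> clamp l r = r.
Proof. by move=> /andP[r0 rl]; rewrite /clamp min_l// max_r. Qed.

Lemma clamp_lipschitz l r r' : 0 <= l -> `|clamp l r - clamp l r'| <= `|r - r'|.
Proof.
move=> l0; rewrite /clamp /Num.max /Num.min.
have := ler_norm (r - r'); have := ler_norm (- (r - r')); rewrite normrN => h1 h2.
rewrite ler_norml.
have [a1|a1] := ltP r l; have [a2|a2] := ltP r' l;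
  have [b1|b1] := ltP 0 r; have [b2|b2] := ltP 0 r';
  have [b3|b3] := ltP 0 l; by apply/andP; lra.
Qed.

End Clamp.

Section Paths.
Context {R : realType} {X : completeMetricType R}.

(** Real parameters are clamped so that geodesics become total functions of a real
    variable. *)
Definition clampI (r : R) : unit_itv R := exist _ (clamp 1 r) (clamp_itv r ler01).

Definition at_real (c : geodesic X) (r : R) : X := c (clampI r).

Lemma clampI_val (t : unit_itv R) : clampI (val t) = t.
Proof. by apply: val_inj => /=; apply: clamp_id; case: t. Qed.

Lemma at_real0 (c : geodesic X) : at_real c 0 = c itv0.
Proof. by rewrite /at_real -(clampI_val itv0). Qed.

Lemma at_real1 (c : geodesic X) : at_real c 1 = c itv1.
Proof. by rewrite /at_real -(clampI_val itv1). Qed.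

Lemma at_real_lipschitz (c : geodesic X) r r' :
  mdist (at_real c r) (at_real c r') <= `|r - r'| * mdist (c itv0) (c itv1).
Proof.
rewrite /at_real (curveP c (clampI r') (clampI r)); apply: ler_wpM2r; first exact: mdist_ge0.
exact: clamp_lipschitz.
Qed.

(** Concatenation at y of a geodesic from p with a prescribed geodesic e,
    parametrized by arc length and constant outside its range; prescribing e
    lets two such paths share their final part. *)
Lemma path_exists (p y z : X) (s t : R) (e : geodesic X) :
  geodesic_space X -> 0 < s -> 0 < t -> mdist p y = s -> mdist y z = t ->
  e itv0 = y -> e itv1 = z ->
  exists c : R -> X, [/\ c 0 = p, forall r, s <= r -> c r = at_real e ((r - s) / t),
    c (s + t) = z & forall r r', mdist (c r) (c r') <= `|r - r'|].
Proof.
move=> geoX s0 t0 py yz e0 e1; have [a [a0 a1]] := geoX p y.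
pose c r := if r <= s then at_real a (r / s) else at_real e ((r - s) / t).
have lipa r r' : mdist (at_real a (r / s)) (at_real a (r' / s)) <= `|r - r'|.
  apply: le_trans (at_real_lipschitz _ _ _) _.
  by rewrite a0 a1 py -mulrBl normrM (gtr0_norm (_ : 0 < s^-1)) ?invr_gt0// mulfVK// gt_eqF.
have lipe r r' : mdist (at_real e ((r - s) / t)) (at_real e ((r' - s) / t)) <= `|r - r'|.
  apply: le_trans (at_real_lipschitz _ _ _) _.
  rewrite e0 e1 yz -mulrBl normrM (gtr0_norm (_ : 0 < t^-1)) ?invr_gt0// mulfVK ?gt_eqF//.
  by rewrite [X in `|X| <= _](_ : _ = r - r')//; ring.
have as_ : at_real a (s / s) = y by rewrite divff ?gt_eqF// at_real1.
have es : at_real e ((s - s) / t) = y by rewrite subrr mul0r at_real0.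
have ce r : s <= r -> c r = at_real e ((r - s) / t).
  rewrite le_eqVlt /c => /predU1P[<-|sr]; first by rewrite lexx as_ es.
  by rewrite leNgt sr.
exists c; split => //.
- by rewrite /c ltW// mul0r at_real0.
- by rewrite ce ?lerDl ?ltW// addrC addKr divff ?gt_eqF// at_real1.
suff H r r' : r <= r' -> mdist (c r) (c r') <= `|r - r'|.
  move=> r r'; have [/H//|/ltW/H] := leP r r'.
  by rewrite metric_sym distrC.
move=> rr'; have [rs|sr] := leP r s; last first.
  by rewrite !ce ?(ltW sr)//; exact: le_trans (ltW sr) rr'.
have cr : c r = at_real a (r / s) by rewrite /c rs.
have [r's|sr'] := leP r' s; first by rewrite cr /c r's.
rewrite (ce r' (ltW sr')) cr; apply: le_trans (metric_triangle _ y _) _.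
have := lipa r s; have := lipe s r'; rewrite as_ es.
rewrite !ler0_norm ?subr_le0 ?(ltW sr')//; lra.
Qed.

End Paths.

Section Strip.
Context {R : realType} {X : completeMetricType R} {G : topologicalGroupType}.
Variable act : G -> X -> X.
Hypothesis cptG : compact [set: G].
Hypothesis cact : continuous_action act.
Hypothesis iact : isometric_action act.

Local Notation od := (orbit_dist act).

(** The path is no longer than the distance between the two orbits, so the triangle
    inequality through each of its points is an equality. *)
Lemma path_level (x p z : X) (l : R) (c : R -> X) :
  0 <= l -> od x p = 0 -> od x z = l -> c 0 = p -> c l = z ->
  (forall r r', mdist (c r) (c r') <= `|r - r'|) ->
  forall r, 0 <= r <= l -> od x (c r) = r /\ od (c r) z = l - r.
Proof.
move=> l0 xp xz c0 cl lip r /andP[r0 rl].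
have h1 : od x (c r) <= r.
  apply: le_trans (orbit_dist_triangle cptG cact iact p _ _) _; rewrite xp add0r.
  apply: le_trans (orbit_dist_mdist cact _ _) _; rewrite -c0.
  by apply: le_trans (lip _ _) _; rewrite sub0r normrN ger0_norm.
have h2 : od (c r) z <= l - r.
  apply: le_trans (orbit_dist_mdist cact _ _) _; rewrite -cl.
  by apply: le_trans (lip _ _) _; rewrite distrC ger0_norm// subr_ge0.
have := orbit_dist_triangle cptG cact iact (c r) x z; rewrite xz => h3.
by split; apply/eqP; rewrite eq_le; apply/andP; lra.
Qed.

Variables (x z : X) (l : R).
Hypothesis l0 : 0 <= l.

(** For l the distance between the orbits of x and z, the union of the orbits
    between them. *)
Definition strip : set X := [set v | od x v + od v z <= l].

Hypothesis strip_uniq : forall v v', strip v -> strip v' -> od x v = od x v' ->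
  exists g, act g v = v'.

Lemma strip_act g v : strip (act g v) <-> strip v.
Proof.
have [act1 _ _] := cact; rewrite /strip /=.
have -> : od x (act g v) = od x v by rewrite -[in LHS](act1 x) orbit_dist_act.
by have -> : od (act g v) z = od v z by rewrite -[in LHS](act1 z) orbit_dist_act.
Qed.

Lemma strip_closed : closed strip.
Proof.
apply: (@closed_comp _ _ (fun v => od x v + od v z) [set r | r <= l]); last exact: closed_le.
move=> v _; apply: cvgD; first exact: orbit_dist_continuous.
apply: (lipschitz_continuous (f := fun v => od v z)) => a b.
by rewrite !(orbit_dist_sym cptG cact iact _ z); exact: orbit_dist_lipschitz.
Qed.

Lemma strip_level v : strip v -> 0 <= od x v <= l.
Proof.
have := orbit_dist_ge0 cptG cact x v; have := orbit_dist_ge0 cptG cact v z.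
by rewrite /strip /= => *; apply/andP; lra.
Qed.

Variable c : R -> X.
Hypothesis c_lip : forall r r', mdist (c r) (c r') <= `|r - r'|.
Hypothesis c_level : forall r, 0 <= r <= l -> od x (c r) = r /\ od (c r) z = l - r.

Lemma path_strip r : 0 <= r <= l -> strip (c r).
Proof. by move=> /c_level[h1 h2]; rewrite /strip /= h1 h2 addrC subrK. Qed.

Lemma strip_path v : strip v -> exists g, act g (c (od x v)) = v.
Proof.
move=> Sv; have vl := strip_level Sv.
by apply: strip_uniq => //; [exact: path_strip|case: (c_level vl)].
Qed.

(** The strip is a continuous image of G x [0, l], each of its orbits meeting the
    path c. *)
Lemma strip_compact : compact strip.
Proof.
have -> : strip = (fun p : G * R => act p.1 (c p.2)) @` ([set: G] `*` `[0, l]).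
  apply/seteqP; split => [v Sv|_ [[g r] [_ /= rl] <-]].
    have [g gv] := strip_path Sv; exists (g, od x v) => //; split => //=.
    by rewrite in_itv; exact: strip_level.
  by rewrite strip_act; apply: path_strip; rewrite in_itv in rl.
apply: continuous_compact; last exact: compact_setX (@segment_compact _ _ _).
apply: continuous_subspaceT => -[g r].
have cc : {for r, continuous c}.
  move=> A /nbhs_ballP[e /= e0 eA].
  have := nbhsx_ballx r e e0; apply: filterS => r'; rewrite -ball_normE /= => rr'.
  by apply: eA; rewrite ballEmdist /=; exact: le_lt_trans (c_lip _ _) rr'.
have pc : (fun q : G * R => (q.1, c q.2)) @ (g, r) --> (g, c r).
  apply: (@cvg_pair _ _ _ (nbhs (g, r)) (nbhs g) (nbhs (c r))); first exact: cvg_fst.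
  exact: cvg_comp (@cvg_snd _ _ (nbhs g) (nbhs r) _) cc.
exact: cvg_comp pc (@act_continuous_pair _ _ _ act cact (g, c r)).
Qed.

End Strip.

(** * Right-invariant random group elements *)

Section ActionPseudometric.
Context {R : realType} {X : completeMetricType R} {G : topologicalGroupType}.
Variable act : G -> X -> X.
Hypothesis cptG : compact [set: G].
Hypothesis cact : continuous_action act.
Hypothesis iact : isometric_action act.

Variable K : set X.
Hypothesis cptK : compact K.
Hypothesis K0 : K !=set0.
Hypothesis KG : forall g v, K v -> K (act g v).

(** Taking the supremum over an invariant set makes this pseudometric
    right-invariant. *)
Definition act_dist (g h : G) : R :=
  sup [set mdist (act g v) (act h v) | v in K].

Let act_dist_has_sup g h : has_sup [set mdist (act g v) (act h v) | v in K].
Proof.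
split; first by have [v Kv] := K0; exists (mdist (act g v) (act h v)), v.
have [u Ku] := K0.
have [||m Km mmax] := @compact_EVT_max X R (mdist u) K _ cptK.
- by exists u.
- apply: continuous_subspaceT => v; apply: lipschitz_continuous => a b.
  by rewrite !(metric_sym u); exact: mdist_lipschitz.
exists (mdist u m + mdist u m) => _ [v Kv <-].
apply: le_trans (metric_triangle _ u _) _; rewrite (metric_sym _ u).
by apply: lerD; apply: mmax; rewrite inE; exact: KG.
Qed.

Lemma le_act_dist g h v : K v -> mdist (act g v) (act h v) <= act_dist g h.
Proof. by move=> Kv; apply: sup_upper_bound; [exact: act_dist_has_sup|exists v]. Qed.

Lemma act_dist_le g h r : (forall v, K v -> mdist (act g v) (act h v) <= r) ->
  act_dist g h <= r.
Proof.
move=> H; apply: ge_sup; first by case: (act_dist_has_sup g h).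
by move=> _ [v Kv <-]; exact: H.
Qed.

Lemma act_distxx g : act_dist g g = 0.
Proof.
apply/eqP; rewrite eq_le; apply/andP; split.
  by apply: act_dist_le => v _; rewrite mdistxx.
by have [v Kv] := K0; apply: le_trans (le_act_dist g g Kv); rewrite mdistxx.
Qed.

Lemma act_dist_sym g h : act_dist g h = act_dist h g.
Proof.
by congr sup; apply/seteqP; split => _ [v Kv <-]; exists v => //; rewrite metric_sym.
Qed.

Lemma act_dist_triangle h g k : act_dist g k <= act_dist g h + act_dist h k.
Proof.
apply: act_dist_le => v Kv; apply: le_trans (metric_triangle _ (act h v) _) _.
by apply: lerD; exact: le_act_dist.
Qed.

Lemma act_dist_mulr k g h : act_dist (g * k)%g (h * k)%g = act_dist g h.
Proof.
have [act1 actM _] := cact.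
apply/eqP; rewrite eq_le; apply/andP; split; apply: act_dist_le => v Kv.
  by rewrite !actM; apply: le_act_dist; exact: KG.
have := le_act_dist (g * k)%g (h * k)%g (KG k^-1%g Kv).
by rewrite !actM !(actVK cact).
Qed.

Lemma act_dist_nbhs g e : 0 < e -> nbhs g [set h | act_dist g h < e].
Proof.
move=> e0.
have : \forall h \near g, K `<=` [set v | mdist (act g v) (act h v) < e / 2].
  apply: (compact_near_coveringP K).1 => // v Kv.
  have c1 := @act_continuous_pair _ _ _ act cact (g, v).
  have e4 : 0 < e / 4 by rewrite divr_gt0.
  have H := c1 _ (nbhsx_ballx (act g v) _ e4).
  have [[/= A B] [nA nB] AB] :
      nbhs (g, v) [set p | ball (act g v) (e / 4) (act p.1 p.2)] by exact: H.
  exists (B, A) => //= -[v' h] /= [Bv' Ah].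
  have := AB (h, v') (conj Ah Bv'); have := AB (g, v') (conj (nbhs_singleton nA) Bv').
  rewrite /= !ballEmdist /= => h1 h2.
  have := metric_triangle (act g v') (act g v) (act h v').
  by rewrite (metric_sym _ (act g v)); lra.
apply: filterS => h Hh /=.
apply: (@le_lt_trans _ _ (e / 2)); last by lra.
by apply: act_dist_le => v Kv; exact/ltW/Hh.
Qed.

(** The pair Om, io stands for a random element of the group. *)
Lemma invariant_sampler :
  exists d (Om : measurableType d) (P : probability Om R) (io : Om -> G),
  resolvable [set: Om] (fun w w' => act_dist (io w) (io w')) /\
  forall k (A : set G), P [set w | A (io w * k)%g] = P [set w | A (io w)].
Proof.
have [d [Om [P [io [mball inv]]]]] := invariant_probability cptG act_distxx
  act_dist_sym act_dist_triangle act_dist_nbhs act_dist_mulr.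
exists d, Om, P, io; split => //.
have net (e : R) : 0 < e -> exists s : seq G, forall h, exists2 g, g \in s & act_dist g h < e.
  move=> e0.
  pose TG : ptopologicalType :=
    HB.pack (G : Type) (Topological.on G) (isPointed.Build G 1%g).
  have cptTG : cover_compact [set: G].
    by have : @compact TG [set: G] := cptG; rewrite compact_cover.
  pose B (g : G) : set G := interior [set h | act_dist g h < e].
  have [||s _ sG] := cptTG G setT B.
  - by move=> g _; exact: open_interior.
  - by move=> g _; exists g => //; exact: act_dist_nbhs.
  exists (finmap.enum_fset s) => h.
  by have [g gs /interior_subset gh] := sG h I; exists g.
have r0 n : 0 < n.+1%:R^-1 / 2 :> R by rewrite divr_gt0.
pose s n : seq G := projT1 (cid (net _ (r0 n))).
have sP n h : exists2 g, g \in s n & act_dist g h < n.+1%:R^-1 / 2.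
  by rewrite /s; case: cid.
exists nat, (fun n i => [set w | act_dist (nth 1%g (s n) i) (io w) < n.+1%:R^-1 / 2]).
split => //.
- move=> n w _; have [g gs gw] := sP n (io w).
  by exists (index g (s n)); rewrite /= nth_index.
- move=> n i p q /= h1 h2.
  apply: le_lt_trans (act_dist_triangle (nth 1%g (s n) i) _ _) _.
  by rewrite [ltRHS]splitr (act_dist_sym (io p)); exact: ltrD.
Qed.

End ActionPseudometric.

(** * Absolute continuity of random orbit points *)

Lemma null_sections d1 d2 (T1 : measurableType d1) (T2 : measurableType d2)
    (R : realType) (m1 : {sigma_finite_measure set T1 -> \bar R})
    (m2 : {sigma_finite_measure set T2 -> \bar R}) (E : set (T1 * T2)) :
  measurable E -> (forall x, m2 (xsection E x) = 0%E) ->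
  measurable [set y | m1 (ysection E y) != 0%E] /\
  m2 [set y | m1 (ysection E y) != 0%E] = 0%E.
Proof.
move=> mE E0; have mf := measurable_fun_ysection m1 mE.
have mN : measurable [set y | m1 (ysection E y) != 0%E].
  by have := emeasurable_neq measurableT mf 0%E; rewrite setTI.
split=> //.
have := indic_fubini_tonelli m1 m2 mE.
rewrite indic_fubini_tonelli_FE// indic_fubini_tonelli_GE//.
rewrite integral0_eq; last by move=> x _ /=; exact: E0.
move=> /esym int0.
have abs0 : (\int[m2]_y `|(m1 \o ysection E) y| = 0)%E.
  by rewrite -[RHS]int0; apply: eq_integral => y _; rewrite gee0_abs.
have [M [mM M0 subM]] := (ae_eq_integral_abs m2 measurableT mf).1 abs0.
apply: (subset_measure0 _ _ _ M0) => // y /= Ny.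
by apply: subM => /=; move/(_ I) => H; move: Ny; rewrite H eqxx.
Qed.

Section NullLevels.
Context {R : realType} {X : completeMetricType R} {G : topologicalGroupType}.
Variable act : G -> X -> X.
Hypothesis cact : continuous_action act.
Hypothesis iact : isometric_action act.
Hypothesis sepX : separable X.
Variable m : {measure set (borel X) -> \bar R}.
Hypothesis m_inv : measure_preserving act m.

Variables (K : set X).
Hypotheses (cptK : compact K) (K0 : K !=set0) (closedK : closed K).
Hypothesis KG : forall g v, K v -> K (act g v).
Hypothesis mK_fin : (m (K : set (borel X)) < +oo)%E.

Let mK : measurable (K : set (borel X)).
Proof. exact: measurable_closed. Qed.

Context d (Om : measurableType d) (P : probability Om R) (io : Om -> G).
Hypothesis Om_res : resolvable [set: Om] (fun w w' => act_dist act K (io w) (io w')).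
Hypothesis P_inv : forall k (A : set G), P [set w | A (io w * k)%g] = P [set w | A (io w)].

Lemma measurable_act_strip (A : set (borel X)) : measurable A ->
  measurable [set p : Om * borel X | K p.2 /\ A (act (io p.1) p.2)].
Proof.
have mact : measurable_fun setT (fun p : Om * borel X =>
    (if `[< K p.2 >] then act (io p.1) p.2 else p.2 : X) : borel X).
  apply: measurable_fun_open => U oU.
  rewrite (_ : _ @^-1` _ = [set p | K p.2 /\ U (act (io p.1) p.2)] `|`
      [set p | (~` K `&` U) p.2]); last first.
    by apply/seteqP; split => p /=; case: asboolP => // Kp; [left|right|case|case] => // -[].
  apply: measurableU.
    apply: (measurable_resolvable Om_res (resolvable_separable sepX mK)).
      by move=> p [].
    move=> w v [/= Kv Ugv].
    have [e /= e0 eU] : nbhs_ball (act (io w) v) U.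
      by apply/nbhs_ballP; exact: open_nbhs_nbhs.
    exists (e / 2) => [|w' v' _ Kv' ww' vv']; first by rewrite divr_gt0.
    split=> //; apply: eU; rewrite ballEmdist /=.
    apply: le_lt_trans (metric_triangle _ (act (io w) v') _) _.
    rewrite iact [ltRHS]splitr; apply: ltrD => //.
    by apply: le_lt_trans ww'; exact: le_act_dist.
  rewrite (_ : [set p | _] = snd @^-1` ((~` K `&` U) : set (borel X)))//.
  rewrite -[X in measurable X]setTI; apply: measurable_snd => //.
  by apply: measurableI; [exact: measurableC|exact: measurable_open].
move=> mA; have := mact measurableT _ mA; rewrite setTI => mAct.
rewrite (_ : [set p | _] = (snd @^-1` (K : set (borel X))) `&`
    ((fun p : Om * borel X => (if `[< K p.2 >] then act (io p.1) p.2 else p.2 : X)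
      : borel X) @^-1` A)); last first.
  by apply/seteqP; split => p /= -[Kp]; case: asboolP.
apply: measurableI => //; rewrite -[X in measurable X]setTI.
exact: measurable_snd.
Qed.

Variables (l : R) (l0 : 0 <= l) (f : X -> R) (c : R -> X).
Hypothesis cf : continuous f.
Hypothesis c_lip : forall r r', mdist (c r) (c r') <= `|r - r'|.
Hypothesis cK : forall r, 0 <= r <= l -> K (c r).
Hypothesis fK : forall v, K v -> 0 <= f v <= l.
Hypothesis orbitK : forall v, K v -> exists g, act g (c (f v)) = v.

Let clampc r := c (clamp l r).

Let clampcK r : K (clampc r). Proof. exact/cK/clamp_itv. Qed.

Lemma measurable_act_path e (U : measurableType e) (s : U -> R) (A : set (borel X)) :
  measurable_fun setT s -> measurable A ->
  measurable [set p : Om * U | A (act (io p.1) (clampc (s p.2)))].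
Proof.
move=> ms; have mact : measurable_fun setT
    (fun p : Om * U => act (io p.1) (clampc (s p.2)) : borel X).
  apply: measurable_fun_open => V oV.
  apply: (measurable_resolvable Om_res (resolvable_pair ms ms)) => // w u Vgu.
  have [r /= r0 rV] : nbhs_ball (act (io w) (clampc (s u))) V.
    by apply/nbhs_ballP; exact: open_nbhs_nbhs.
  exists (r / 2) => [|w' u' _ _ ww' uu']; first by rewrite divr_gt0.
  apply: rV; rewrite ballEmdist /=.
  apply: le_lt_trans (metric_triangle _ (act (io w) (clampc (s u'))) _) _.
  rewrite iact [ltRHS]splitr; apply: ltrD.
    apply: le_lt_trans (c_lip _ _) _; apply: le_lt_trans (clamp_lipschitz _ _ l0) _.
    by move: uu'; rewrite gt_max => /andP[].
  by apply: le_lt_trans ww'; exact: le_act_dist.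
by move=> mA; have := mact measurableT _ mA; rewrite setTI.
Qed.

(** Averaging over the group disintegrates m along f. By Tonelli and the invariance
    of m, the translate of v by a random group element misses A almost surely, for
    almost every v in K; by right invariance of the law of the group element, this
    depends on the orbit of v only, that is on its level. *)
Lemma null_levels (A : set (borel X)) : measurable A -> m A = 0%E ->
  exists N : set R, [/\ measurable N,
    m (K `&` f @^-1` N) = 0%E &
    forall r, ~ N r -> P [set w | A (act (io w) (clampc r))] = 0%E].
Proof.
move=> mA A0.
pose mKf : {finite_measure set (borel X) -> \bar R} := mfrestr mK mK_fin.
pose E := [set p : Om * borel X | K p.2 /\ A (act (io p.1) p.2)].
have mE : measurable E by exact: measurable_act_strip.
have xE w : mKf (xsection E w) = 0%E.
  rewrite /mKf /= /mfrestr /mrestr.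
  have mgA : measurable (act (io w) @^-1` A : set (borel X)).
    have mw : measurable_fun setT (act (io w) : borel X -> borel X).
      apply: measurable_fun_open => U oU; apply: measurable_open.
      rewrite openE => v Ugv.
      have [e /= e0 eU] : nbhs_ball (act (io w) v) U.
        by apply/nbhs_ballP; exact: open_nbhs_nbhs.
      apply: filterS (nbhsx_ballx v e e0) => v' vv'; apply: eU.
      by move: vv'; rewrite !ballEmdist /= iact.
    by have := mw measurableT _ mA; rewrite setTI.
  apply: (@subset_measure0 _ _ _ m _ (act (io w) @^-1` A)) => //.
  - by apply: measurableI => //; exact: measurable_xsection.
  - by move=> v [] /=; rewrite /xsection /= inE => -[].
  by have := m_inv (io w) mA; rewrite A0.
have [mM M0] := null_sections P mE xE.
pose E2 := [set p : Om * R | A (act (io p.1) (clampc p.2))].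
have mE2 : measurable E2.
  exact: (@measurable_act_path _ R idfun A (@measurable_id _ _ setT) mA).
pose N := [set r : R | P (ysection E2 r) != 0%E].
have mN : measurable N.
  have := measurable_fun_ysection P mE2 => mf.
  by have := emeasurable_neq measurableT mf 0%E; rewrite setTI.
exists N; split => //.
  have M0' : m ([set v | P (ysection E v) != 0%E] `&` K) = 0%E by exact: M0.
  apply: (subset_measure0 _ _ _ M0').
  - apply: measurableI => //; rewrite -[X in measurable X]setTI.
    exact: measurable_fun_continuous.
  - exact: measurableI.
  - move=> v [Kv Nv]; split => //=; have [g gv] := orbitK Kv.
    suff -> : P (ysection E v) = P (ysection E2 (f v)) by exact: Nv.
    have [_ actM _] := cact.
    have -> : ysection E v = [set w | A (act (io w * g)%g (clampc (f v)))].
      rewrite ysectionE; apply/seteqP; split => w /=.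
        by move=> [_]; rewrite actM /clampc clamp_id ?fK// gv.
      by rewrite actM /clampc clamp_id ?fK// gv; split.
    by rewrite ysectionE; exact: (P_inv g [set h | A (act h (clampc (f v)))]).
move=> r /negP; rewrite negbK => /eqP.
by rewrite /E2 ysectionE.
Qed.

End NullLevels.

(** * Random segments of a path *)

Lemma half_sum_exists d (T : measurableType d) (R : realType) (P1 P2 : probability T R) :
  exists Q : probability T R,
  (forall A, Q A = 2^-1%:E * P1 A + 2^-1%:E * P2 A)%E /\
  forall h : T -> \bar R, measurable_fun setT h -> (forall x, 0 <= h x)%E ->
    (\int[Q]_x h x = 2^-1%:E * (\int[P1]_x h x) + 2^-1%:E * (\int[P2]_x h x))%E.
Proof.
have h0 : (0 <= 2^-1 :> R) by rewrite invr_ge0.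
pose k : {nonneg R} := NngNum h0.
pose M := measure_add (mscale k P1) (mscale k P2).
have ME A : M A = (2^-1%:E * P1 A + 2^-1%:E * P2 A)%E by rewrite /M measure_addE.
have MT : M setT = 1%E.
  rewrite ME !probability_setT !mule1 -EFinD; congr EFin; lra.
have [Q QE] := probability_of_measure MT.
exists Q; split=> [A|h mh hge]; first by rewrite QE; exact: ME.
rewrite QE /M ge0_integral_measure_add//.
by rewrite !ge0_integral_mscale.
Qed.

Section SegmentGeodesic.
Context {R : realType} {X : completeMetricType R} {G : topologicalGroupType}.
Variable act : G -> X -> X.
Hypothesis cact : continuous_action act.
Hypothesis iact : isometric_action act.
Variables (l : R) (c : R -> X).
Hypothesis l0 : 0 <= l.
Hypothesis c_iso : forall r r', 0 <= r <= l -> 0 <= r' <= l ->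
  mdist (c r) (c r') = `|r - r'|.

(* The levels are clamped to the range of the path, so that a segment exists for
   all real a and b. *)
Let pos (a b : R) (t : unit_itv R) : R :=
  clamp l a + val t * (clamp l b - clamp l a).

Let pos_itv a b t : 0 <= pos a b t <= l.
Proof.
have := clamp_itv a l0; have := clamp_itv b l0; rewrite /pos.
move: (clamp l a) (clamp l b) => u v /andP[v0 vl] /andP[u0 ul].
have /andP[t0 t1] := valP t; move: (val t) t0 t1 => {}t t0 t1.
by apply/andP; split; nra.
Qed.

Let segment_subproof g a b (s t : unit_itv R) :
  mdist (act g (c (pos a b t))) (act g (c (pos a b s))) =
  `|val t - val s| * mdist (act g (c (pos a b itv0))) (act g (c (pos a b itv1))).
Proof.
rewrite !iact !c_iso ?pos_itv// /pos /= mul0r mul1r -normrM.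
have -> : clamp l a + val t * (clamp l b - clamp l a) -
  (clamp l a + val s * (clamp l b - clamp l a)) =
  (val t - val s) * (clamp l b - clamp l a) by ring.
have -> : clamp l a + 0 - (clamp l a + (clamp l b - clamp l a)) =
  - (clamp l b - clamp l a) by ring.
by rewrite mulrN normrN.
Qed.

Definition segment g a b : geodesic X := Geodesic (segment_subproof g a b).

Lemma segmentE g a b t : 0 <= a <= l -> 0 <= b <= l ->
  segment g a b t = act g (c (a + val t * (b - a))).
Proof. by move=> al bl; rewrite /= /pos !clamp_id. Qed.

Lemma segment0 g a b : 0 <= a <= l -> segment g a b itv0 = act g (c a).
Proof. by move=> al; rewrite /= /pos /= clamp_id// mul0r addr0. Qed.

Lemma segment1 g a b : 0 <= b <= l -> segment g a b itv1 = act g (c b).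
Proof. by move=> bl; rewrite /= /pos /= (clamp_id bl) mul1r addrC subrK. Qed.

Variable K : set X.
Hypotheses (cptK : compact K) (K0 : K !=set0).
Hypothesis KG : forall g v, K v -> K (act g v).
Hypothesis cK : forall r, 0 <= r <= l -> K (c r).

(** Segments depend continuously on the group element and on the two levels, for
    distances that are resolvable; hence a segment chosen at random is a
    measurable function of the randomness. *)
Lemma segment_dist g a b g' a' b' :
  mdist (segment g a b) (segment g' a' b') <=
  act_dist act K g g' + Num.max `|a - a'| `|b - b'|.
Proof.
apply: sup_dist_le => t /=.
apply: le_trans (metric_triangle _ (act g (c (pos a' b' t))) _) _.
rewrite addrC; apply: lerD; first by apply: le_act_dist => //; exact: cK.
rewrite iact c_iso//.
have ha := clamp_lipschitz a a' l0; have hb := clamp_lipschitz b b' l0.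
set M := Num.max _ _.
have {}ha : `|clamp l a - clamp l a'| <= M by rewrite le_max ha.
have {}hb : `|clamp l b - clamp l b'| <= M by rewrite le_max hb orbT.
rewrite /pos; have /andP[t0 t1] := valP t; move: (val t) t0 t1 => {}t t0 t1.
move: (clamp l a) (clamp l b) (clamp l a') (clamp l b') ha hb => u v u' v'.
rewrite !ler_norml => /andP[? ?] /andP[? ?].
by apply/andP; split; nra.
Qed.

Context d (Om : measurableType d) (io : Om -> G).
Hypothesis Om_res : resolvable [set: Om] (fun w w' => act_dist act K (io w) (io w')).

Lemma measurable_segment e (U : measurableType e) (s t : U -> R) :
  measurable_fun setT s -> measurable_fun setT t ->
  measurable_fun setT
    (fun p : Om * U => segment (io p.1) (s p.2) (t p.2) : borel (geodesic X)).
Proof.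
move=> ms mt; apply: measurable_fun_open => V oV.
apply: (measurable_resolvable Om_res (resolvable_pair ms mt)) => // w u Vwu.
have [r /= r0 rV] : nbhs_ball (segment (io w) (s u) (t u)) V.
  by apply/nbhs_ballP; exact: open_nbhs_nbhs.
exists (r / 2) => [|w' u' _ _ ww' uu']; first by rewrite divr_gt0.
apply: rV; rewrite ballEmdist /=.
by apply: le_lt_trans (segment_dist _ _ _ _ _ _) _; rewrite [ltRHS]splitr; exact: ltrD.
Qed.

End SegmentGeodesic.

Lemma measurable_geodesic_eval (R : realType) (X : completeMetricType R) (t : unit_itv R) :
  measurable_fun setT (fun c : borel (geodesic X) => (c : geodesic X) t : borel X).
Proof.
apply: measurable_fun_open => U oU; apply: measurable_open.
rewrite openE => c Uct.
have [e /= e0 eU] : nbhs_ball (c t) U by apply/nbhs_ballP; exact: open_nbhs_nbhs.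
have := nbhsx_ballx (c : geodesic X) e e0; apply: filterS => c' cc'; apply: eU.
move: cc'; rewrite !ballEmdist /=; apply: le_lt_trans; exact: le_sup_dist.
Qed.

Lemma measurable_endpoints (R : realType) (X : completeMetricType R) :
  measurable_fun setT (@endpoints R X).
Proof.
exact: measurable_fun_pair (measurable_geodesic_eval itv0)
  (measurable_geodesic_eval itv1).
Qed.

Lemma measurable_mdist (R : realType) (X : completeMetricType R) : separable X ->
  measurable_fun setT (fun p : borel X * borel X => mdist (p.1 : X) (p.2 : X)).
Proof.
move=> sepX; have res := resolvable_separable sepX (@measurableT _ (borel X)).
apply: (measurability _ (RGenOpens.measurableE R)) => _ [_ [a [b ->]] <-].
rewrite setTI; apply: (measurable_resolvable res res) => // p q.
rewrite /= in_itv/= => /andP[ap pb].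
exists (Num.min ((mdist (p : X) (q : X) - a) / 2) ((b - mdist (p : X) (q : X)) / 2)).
  by rewrite lt_min !divr_gt0// subr_gt0.
move=> p' q' _ _; rewrite !lt_min => /andP[h1 h2] /andP[h3 h4].
have t1 := metric_triangle (p : X) (p' : X) (q : X).
have t2 := metric_triangle (p' : X) (q' : X) (q : X).
have t3 := metric_triangle (p' : X) (p : X) (q' : X).
have t4 := metric_triangle (p : X) (q : X) (q' : X).
rewrite (metric_sym (q' : X) (q : X)) in t2; rewrite (metric_sym (p' : X) (p : X)) in t3.
by rewrite in_itv/=; apply/andP; split; lra.
Qed.

(** * Optimality of comonotone plans *)

(** Restricting m to the levels between a and b and normalizing gives a law of the
    level that is absolutely continuous by construction. *)
Lemma level_law (R : realType) (X : completeMetricType R)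
    (m : {measure set (borel X) -> \bar R}) (K : set (borel X)) (f : borel X -> R) (a b : R) :
  measurable K -> measurable_fun setT f ->
  (0 < m (K `&` f @^-1` `[a, b]) < +oo)%E ->
  exists P : probability R R, P `[a, b]%classic = 1%E /\
    forall B : set R, measurable B -> m (K `&` f @^-1` B) = 0%E -> P B = 0%E.
Proof.
move=> mK mf /andP[W0 Woo]; set W := K `&` _ in W0 Woo.
have mpre (B : set R) : measurable B -> measurable (f @^-1` B).
  by move=> mB; rewrite -[X in measurable X]setTI; exact: mf.
have mW : measurable W by apply: measurableI => //; exact: mpre.
have Wfin : m W \is a fin_num by rewrite ge0_fin_numE.
have w0 : 0 < fine (m W) by rewrite fine_gt0 ?W0.
have k0 : 0 <= (fine (m W))^-1 by rewrite invr_ge0 ltW.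
pose k : {nonneg R} := NngNum k0.
pose M := mscale k (mrestr m mW).
have MT : M setT = 1%E.
  rewrite /M /mscale /= /mrestr setTI -(fineK Wfin) -EFinM mulVf//.
  by rewrite gt_eqF.
have [Q QE] := probability_of_measure MT.
have [P PE] := push_probability Q mf.
have PB B : P B = ((fine (m W))^-1%:E * m (f @^-1` B `&` W))%E.
  by rewrite PE; exact: (congr1 (@^~ (f @^-1` B)) QE).
exists P; split=> [|B mB mB0]; rewrite PB.
  rewrite (_ : _ `&` W = W); last first.
    by apply/seteqP; split => v; [case|move=> Wv; split => //; case: Wv].
  by rewrite -(fineK Wfin) -EFinM mulVf// gt_eqF.
rewrite (_ : m (_ `&` W) = 0%E) ?mule0//.
apply: (@subset_measure0 _ _ _ m _ (K `&` f @^-1` B)) => //.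
- by apply: measurableI => //; exact: mpre.
- by apply: measurableI => //; exact: mpre.
by move=> v [Bv [Kv _]].
Qed.

(** As f is 1-Lipschitz, the transport cost of any coupling is at least the mean
    square of the positive part of the loss of level, for which the comonotone
    pair s, t is optimal. A plan moving points from level s to level t at no more
    than this cost is therefore optimal. *)
Lemma comonotone_plan_optimal (R : realType) (X : completeMetricType R)
    (mu0 mu1 : probability (borel X) R) (rho : probability (borel (geodesic X)) R)
    (f : X -> R) (s t : measurableTypeR R -> R) :
  separable X -> (forall u v, `|f u - f v| <= mdist u v) ->
  measurable_fun setT s -> measurable_fun setT t ->
  {homo s : u v / u <= v} -> {homo t : u v / u <= v} ->
  (forall A : set (borel X), measurable A -> rho [set c | A ((c : geodesic X) itv0)] = mu0 A) ->
  (forall A : set (borel X), measurable A -> rho [set c | A ((c : geodesic X) itv1)] = mu1 A) ->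
  (forall r, mu0 [set v | f v <= r] = unit_lebesgue [set u | s u <= r]) ->
  (forall r, mu1 [set v | f v <= r] = unit_lebesgue [set u | t u <= r]) ->
  (\int[rho]_c ((mdist ((c : geodesic X) itv0) ((c : geodesic X) itv1)) ^+ 2)%:E <=
    \int[unit_lebesgue]_u ((Num.max (s u - t u) 0) ^+ 2)%:E)%E ->
  OptGeo mu0 mu1 rho.
Proof.
move=> sepX lipf ms mt hs ht e0 e1 law0 law1 costE.
have mf : measurable_fun setT (f : borel X -> R).
  by apply: measurable_fun_continuous; exact: lipschitz_continuous.
have md2 : measurable_fun setT (fun p : borel X * borel X =>
    ((mdist (p.1 : X) (p.2 : X)) ^+ 2)%:E).
  by apply/measurable_EFinP; apply: measurable_funX; exact: measurable_mdist.
split; first by move=> A mA; split; [exact: e0|exact: e1].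
move=> pi' cpl; rewrite /cost ge0_integral_pushforward//; last 2 first.
- exact: measurable_endpoints.
- by move=> p _; rewrite lee_fin sqr_ge0.
rewrite preimage_setT; apply: le_trans costE _.
pose a' (p : borel X * borel X) := f p.1; pose b' (p : borel X * borel X) := f p.2.
have ma' : measurable_fun setT a' by exact: measurableT_comp mf measurable_fst.
have mb' : measurable_fun setT b' by exact: measurableT_comp mf measurable_snd.
have mle r : measurable ([set v | f v <= r] : set (borel X)) by exact: measurable_set_le.
have Ea r : unit_lebesgue [set u | s u <= r] = pi' [set p | a' p <= r].
  by rewrite -law0; have [<- _] := cpl _ (mle r).
have Eb r : unit_lebesgue [set u | t u <= r] = pi' [set p | b' p <= r].
  by rewrite -law1; have [_ <-] := cpl _ (mle r).
have com r q : [set x | s x <= r] `<=` [set x | t x <= q] \/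
    [set x | t x <= q] `<=` [set x | s x <= r].
  have [sub|/existsNP[u /not_implyP[/= us /negP]]] :=
    pselect ([set x | s x <= r] `<=` [set x | t x <= q]); first by left.
  rewrite -ltNge => tu; right => v /= tv.
  have uv : v <= u.
    rewrite leNgt; apply/negP => /ltW /ht; rewrite leNgt => /negP; apply.
    exact: le_lt_trans tv tu.
  exact: le_trans (hs _ _ uv) us.
apply: le_trans (comonotone_cost_le ms mt ma' mb' Ea Eb com) _.
have mgap : measurable_fun setT (fun p => ((Num.max (a' p - b' p) 0) ^+ 2)%:E).
  apply/measurable_EFinP; apply: measurable_funX; apply: measurable_maxr => //.
  exact: measurable_funB.
have sq0 (r : R) : (0 <= (r ^+ 2)%:E)%E by rewrite lee_fin sqr_ge0.
apply: ge0_le_integral => //.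
move=> p _; rewrite lee_fin lerXn2r ?nnegrE ?mdist_ge0// ?le_max ?lexx ?orbT//.
rewrite ge_max mdist_ge0 andbT.
by apply: le_trans (lipf _ _); exact: ler_norm.
Qed.

(** * The law of a random segment *)

Section SegmentLaw.
Context {R : realType} {X : completeMetricType R} {G : topologicalGroupType}.
Variable act : G -> X -> X.
Hypothesis cact : continuous_action act.
Hypothesis iact : isometric_action act.
Hypothesis sepX : separable X.
Variable m : {measure set (borel X) -> \bar R}.
Hypothesis m_inv : measure_preserving act m.

Variables (K : set X).
Hypotheses (cptK : compact K) (K0 : K !=set0) (closedK : closed K).
Hypothesis KG : forall g v, K v -> K (act g v).
Hypothesis mK_fin : (m (K : set (borel X)) < +oo)%E.

Context d (Om : measurableType d) (P : probability Om R) (io : Om -> G).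
Hypothesis Om_res : resolvable [set: Om] (fun w w' => act_dist act K (io w) (io w')).
Hypothesis P_inv : forall k (A : set G), P [set w | A (io w * k)%g] = P [set w | A (io w)].

Variables (l : R) (f : X -> R) (c : R -> X).
Hypothesis l0 : 0 <= l.
Hypothesis f_lip : forall u v, `|f u - f v| <= mdist u v.
Hypothesis f_act : forall g v, f (act g v) = f v.
Hypothesis fK : forall v, K v -> 0 <= f v <= l.
Hypothesis orbitK : forall v, K v -> exists g, act g (c (f v)) = v.
Hypothesis c_lip : forall r r', mdist (c r) (c r') <= `|r - r'|.
Hypothesis cK : forall r, 0 <= r <= l -> K (c r).
Hypothesis fc : forall r, 0 <= r <= l -> f (c r) = r.

Lemma path_iso r r' : 0 <= r <= l -> 0 <= r' <= l -> mdist (c r) (c r') = `|r - r'|.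
Proof.
move=> rl r'l; apply/eqP; rewrite eq_le c_lip /=.
by rewrite -{1}(fc rl) -{1}(fc r'l).
Qed.

Local Notation TR := (measurableTypeR R).
Variables s t : TR -> R.
Hypotheses (ms : measurable_fun setT s) (mt : measurable_fun setT t).
Hypotheses (sl : forall u, 0 <= s u <= l) (tl : forall u, 0 <= t u <= l).
Hypothesis s_ac : forall N : set R, measurable N -> m (K `&` f @^-1` N) = 0%E ->
  unit_lebesgue (s @^-1` N) = 0%E.
Hypothesis t_ac : forall N : set R, measurable N -> m (K `&` f @^-1` N) = 0%E ->
  unit_lebesgue (t @^-1` N) = 0%E.

Definition random_segment (p : Om * TR) : borel (geodesic X) :=
  segment iact l0 path_iso (io p.1) (s p.2) (t p.2).

Lemma measurable_random_segment : measurable_fun setT random_segment.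
Proof. exact: (measurable_segment iact l0 path_iso cptK K0 KG cK Om_res ms mt). Qed.

Lemma random_segment0 p : (random_segment p : geodesic X) itv0 = act (io p.1) (c (s p.2)).
Proof. exact: segment0. Qed.

Lemma random_segment1 p : (random_segment p : geodesic X) itv1 = act (io p.1) (c (t p.2)).
Proof. exact: segment1. Qed.

Let P2 : probability (Om * TR)%type R := (P \x unit_lebesgue)%E.

(** At almost every level the random orbit point misses the null set A almost
    surely, and the law of the level r does not charge the exceptional levels;
    Tonelli concludes. *)
Lemma random_point_ac (r : TR -> R) (A : set (borel X)) :
  measurable_fun setT r -> (forall u, 0 <= r u <= l) ->
  (forall N : set R, measurable N -> m (K `&` f @^-1` N) = 0%E ->
    unit_lebesgue (r @^-1` N) = 0%E) ->
  measurable A -> m A = 0%E ->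
  P2 [set p | A (act (io p.1) (c (r p.2)))] = 0%E.
Proof.
move=> mr rl r_ac mA A0.
have cf : continuous f by exact: lipschitz_continuous.
have [N [mN N0 NP]] := null_levels cact iact sepX m_inv cptK K0 closedK KG
  mK_fin Om_res P_inv l0 cf c_lip cK fK orbitK mA A0.
have EE : [set p : Om * TR | A (act (io p.1) (c (r p.2)))] =
    [set p : Om * TR | A (act (io p.1) (c (clamp l (r p.2))))].
  by apply/seteqP; split => p /=; rewrite clamp_id.
have mE : measurable [set p : Om * TR | A (act (io p.1) (c (r p.2)))].
  rewrite EE.
  exact: (measurable_act_path iact cptK K0 KG Om_res l0 c_lip cK mr mA).
have := indic_fubini_tonelli P unit_lebesgue mE.
rewrite indic_fubini_tonelli_FE// indic_fubini_tonelli_GE// => tonelli.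
rewrite /P2 /= /product_measure1 tonelli.
have rN0 := r_ac N mN N0.
have mrN : measurable (r @^-1` N) by rewrite -[X in measurable X]setTI; exact: mr.
have mP : measurable_fun setT (P \o ysection [set p : Om * TR | A (act (io p.1) (c (r p.2)))]).
  exact: measurable_fun_ysection.
rewrite -[RHS](@null_set_integral _ _ _ unit_lebesgue _ _ mrN (measurable_funTS mP) rN0).
rewrite -(setUv (r @^-1` N)) ge0_integral_setU//; last 3 first.
- exact: measurableC.
- by rewrite setUv.
- exact/disj_setPCl.
rewrite [X in (_ + X)%E]integral0_eq ?adde0// => u /= nNu.
rewrite ysectionE; have := NP _ nNu; rewrite /= (_ : [set w | _] =
  [set w | A (act (io w) (c (r u)))])//.
by rewrite clamp_id.
Qed.

Lemma snd_law (B : set TR) : measurable B -> P2 [set p | B p.2] = unit_lebesgue B.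
Proof.
move=> mB; rewrite (_ : [set p | _] = setT `*` B); last first.
  by apply/seteqP; split => p //= [].
transitivity (P setT * unit_lebesgue B)%E; first exact: product_measure1E.
by rewrite probability_setT mul1e.
Qed.

(** What the optimality of the plan asks of one of its halves: null sets, level
    laws and integral bounds, all of which pass to the average of two laws. *)
Lemma segment_law : exists rho : probability (borel (geodesic X)) R,
  [/\ rho = pushforward P2 random_segment :> (set _ -> \bar R),
      forall A : set (borel X), measurable A -> m A = 0%E ->
        rho [set e | A ((e : geodesic X) itv0)] = 0%E /\
        rho [set e | A ((e : geodesic X) itv1)] = 0%E,
      forall r, rho [set e | f ((e : geodesic X) itv0) <= r] =
                  unit_lebesgue [set u | s u <= r] /\
                rho [set e | f ((e : geodesic X) itv1) <= r] =
                  unit_lebesgue [set u | t u <= r] &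
      forall h : borel (geodesic X) -> \bar R, measurable_fun setT h ->
        (forall e, 0 <= h e)%E -> forall k : TR -> \bar R, measurable_fun setT k ->
        (forall u, 0 <= k u)%E -> (forall p, h (random_segment p) <= k p.2)%E ->
        (\int[rho]_e h e <= \int[unit_lebesgue]_u k u)%E].
Proof.
have [rho rhoE] := push_probability P2 measurable_random_segment.
exists rho; split => //.
- move=> A mA A0.
  have E0 : random_segment @^-1` [set e | A ((e : geodesic X) itv0)] =
      [set p | A (act (io p.1) (c (s p.2)))].
    by apply/funext => p; exact: (congr1 A (random_segment0 p)).
  have E1 : random_segment @^-1` [set e | A ((e : geodesic X) itv1)] =
      [set p | A (act (io p.1) (c (t p.2)))].
    by apply/funext => p; exact: (congr1 A (random_segment1 p)).
  rewrite rhoE /pushforward E0 E1; split.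
    exact: (random_point_ac ms sl s_ac mA A0).
  exact: (random_point_ac mt tl t_ac mA A0).
- move=> r.
  have f0 p : f ((random_segment p : geodesic X) itv0) = s p.2.
    by rewrite random_segment0 f_act fc.
  have f1 p : f ((random_segment p : geodesic X) itv1) = t p.2.
    by rewrite random_segment1 f_act fc.
  have E0 : random_segment @^-1` [set e | f ((e : geodesic X) itv0) <= r] =
      [set p : Om * TR | [set u | s u <= r] p.2].
    by apply/funext => p; rewrite /preimage /mkset f0.
  have E1 : random_segment @^-1` [set e | f ((e : geodesic X) itv1) <= r] =
      [set p : Om * TR | [set u | t u <= r] p.2].
    by apply/funext => p; rewrite /preimage /mkset f1.
  rewrite rhoE /pushforward E0 E1.
  by split; apply: snd_law; apply: measurable_set_le.
move=> h mh h0 k mk k0 hk.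
rewrite rhoE ge0_integral_pushforward//; last exact: measurable_random_segment.
rewrite preimage_setT.
apply: (@le_trans _ _ (\int[P2]_p k p.2)%E).
  have mhr : measurable_fun setT (h \o random_segment).
    exact: (measurableT_comp mh measurable_random_segment).
  have mkr : measurable_fun setT (fun p : Om * TR => k p.2).
    exact: (measurableT_comp mk measurable_snd).
  apply: ge0_le_integral => // p _; [exact: h0|exact: hk].
have -> : (\int[unit_lebesgue]_u k u = \int[pushforward P2 snd]_u k u)%E.
  apply: eq_measure_integral => B mB _; exact: (esym (snd_law mB)).
by rewrite ge0_integral_pushforward.
Qed.

End SegmentLaw.

(** * Two nearest points contradict essential non-branching *)

Section TwoFeet.
Context {R : realType} {X : completeMetricType R} {G : topologicalGroupType}.
Variable act : G -> X -> X.
Hypothesis cptG : compact [set: G].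
Hypothesis cact : continuous_action act.
Hypothesis iact : isometric_action act.
Hypothesis sepX : separable X.
Hypothesis geoX : geodesic_space X.
Variable m : {measure set (borel X) -> \bar R}.
Hypothesis m_fin : finite_on_balls m.
Hypothesis m_supp : full_support m.
Hypothesis m_enb : essentially_non_branching m.
Hypothesis m_inv : measure_preserving act m.

Local Notation od := (orbit_dist act).

Variables (x y z : X) (g : G) (s t : R).
Hypotheses (s0 : 0 < s) (t0 : 0 < t).
Hypotheses (xy : mdist x y = s) (gxy : mdist (act g x) y = s).
Hypotheses (yz : mdist y z = t) (xz : od x z = s + t).
Hypothesis uniq : forall v v', strip act x z (s + t) v -> strip act x z (s + t) v' ->
  od x v = od x v' -> exists h, act h v = v'.
Hypothesis inner : forall v, strip act x z (s + t) v -> 0 < od x v -> 0 < od v z ->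
  exists2 r, 0 < r & forall v', od v v' < r -> strip act x z (s + t) v'.

Let l := s + t.
Let K : set X := strip act x z l.
Let f : X -> R := od x.
Let l_ge0 : 0 <= l. Proof. by rewrite addr_ge0// ltW. Qed.

Let act1 v : act 1%g v = v. Proof. by case: cact. Qed.

Let f_act h v : f (act h v) = f v.
Proof. by rewrite /f -[in LHS](act1 x) orbit_dist_act. Qed.

Let f_lip u v : `|f u - f v| <= mdist u v.
Proof. exact: orbit_dist_lipschitz. Qed.

Let f0 p : (exists h, act h x = p) -> f p = 0.
Proof.
move=> [h <-]; rewrite f_act; apply/eqP; rewrite eq_le orbit_dist_ge0// andbT.
by rewrite -(mdistxx x); exact: orbit_dist_mdist.
Qed.

(** Both paths go through y, and then along one and the same geodesic to z. *)
Lemma two_paths : exists c1 c2 : R -> X, [/\ c1 0 = x, c2 0 = act g x,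
  forall r, s <= r -> c1 r = c2 r,
  (forall r r', mdist (c1 r) (c1 r') <= `|r - r'|) /\
  (forall r r', mdist (c2 r) (c2 r') <= `|r - r'|) &
  (forall r, 0 <= r <= l -> od x (c1 r) = r /\ od (c1 r) z = l - r) /\
  (forall r, 0 <= r <= l -> od x (c2 r) = r /\ od (c2 r) z = l - r)].
Proof.
have [e [e0 e1]] := geoX y z.
have [c1 [c10 c1e c1l lip1]] := path_exists geoX s0 t0 xy yz e0 e1.
have [c2 [c20 c2e c2l lip2]] := path_exists geoX s0 t0 gxy yz e0 e1.
exists c1, c2; split => //.
- by move=> r sr; rewrite c1e// c2e.
have fx : od x x = 0 by apply: f0; exists 1%g; exact: act1.
have fgx : od x (act g x) = 0 by apply: f0; exists g.
split; first exact: (path_level cptG cact iact l_ge0 fx xz c10 c1l lip1).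
exact: (path_level cptG cact iact l_ge0 fgx xz c20 c2l lip2).
Qed.

(** The levels strictly between 0 and l are interior to the strip, and m has full
    support. *)
Lemma slab_pos (c : R -> X) (a b : R) :
  (forall r, 0 <= r <= l -> od x (c r) = r /\ od (c r) z = l - r) ->
  0 < a -> a < b -> b < l ->
  (0 < m ((K : set (borel X)) `&` f @^-1` `[a, b]))%E.
Proof.
move=> lev a0 ab bl; pose r := (a + b) / 2.
have rl : 0 <= r <= l by apply/andP; rewrite /r; split; lra.
have [fr rz] := lev r rl.
have fr0 : 0 < od x (c r) by rewrite fr /r; lra.
have rz0 : 0 < od (c r) z by rewrite rz /r; lra.
have [d d0 Hd] := inner (path_strip lev rl) fr0 rz0.
pose e := Num.min d ((b - a) / 2).
have e0 : 0 < e by rewrite lt_min d0 divr_gt0// subr_gt0.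
apply: lt_le_trans (m_supp (c r) e0) _.
have mK : measurable (K : set (borel X)).
  exact: (@measurable_closed X K (@strip_closed _ _ _ _ cptG cact iact x z l)).
apply: le_measure; rewrite ?inE.
- apply: measurable_open; rewrite ballEmdist.
  apply: (@open_comp _ _ (mdist (c r)) [set r | r < e]); last exact: open_lt.
  move=> v _; apply: lipschitz_continuous => u w.
  by rewrite !(metric_sym (c r)); exact: mdist_lipschitz.
- apply: measurableI => //; rewrite -[X in measurable X]setTI.
  by apply: measurable_fun_continuous => //; exact: lipschitz_continuous.
move=> v; rewrite ballEmdist /= lt_min => /andP[vd ve]; split.
  by apply: Hd; apply: le_lt_trans vd; exact: orbit_dist_mdist.
rewrite /= in_itv/=.
have := le_lt_trans (f_lip (c r) v) ve.
have -> : f (c r) = r by exact: fr.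
rewrite ltr_norml /r => /andP[h1 h2].
by apply/andP; split; lra.
Qed.

(** One branching pair of geodesics is no contradiction, so the pair is spread over
    a set of positive measure: by a random group element, and by random levels.
    The plan that follows either path with probability one half, from a level
    beyond y down to a level below eps, is optimal between absolutely continuous
    measures, hence lives on non-branching geodesics; but for almost every choice
    of the randomness it charges two distinct segments with a common initial
    part. *)
Lemma two_feet_absurd : act g x <> x -> False.
Proof.
move=> gx; have [c1 [c2 [c10 c20 c12 [lip1 lip2] [lev1 lev2]]]] := two_paths.
have KG h v : K v -> K (act h v) by move=> Kv; apply/strip_act.
have fK v : K v -> 0 <= f v <= l by move=> Kv; exact: strip_level Kv.
have orb1 v : K v -> exists h, act h (c1 (f v)) = v.
  by move=> Kv; apply: (strip_path cptG cact uniq lev1).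
have orb2 v : K v -> exists h, act h (c2 (f v)) = v.
  by move=> Kv; apply: (strip_path cptG cact uniq lev2).
have cK1 r : 0 <= r <= l -> K (c1 r) by move=> rl; apply: path_strip lev1 r rl.
have cK2 r : 0 <= r <= l -> K (c2 r) by move=> rl; apply: path_strip lev2 r rl.
have fc1 r : 0 <= r <= l -> f (c1 r) = r by move=> /lev1[].
have fc2 r : 0 <= r <= l -> f (c2 r) = r by move=> /lev2[].
have cptK : compact K := strip_compact cptG cact iact uniq lip1 lev1.
have closedK : closed K := @strip_closed _ _ _ _ cptG cact iact x z l.
have K0 : K !=set0 by exists (c1 0); apply: cK1; rewrite lexx l_ge0.
have mK : measurable (K : set (borel X)).
  exact: (@measurable_closed X K (@strip_closed _ _ _ _ cptG cact iact x z l)).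
have cf : continuous f by exact: lipschitz_continuous.
have mf : measurable_fun setT (f : borel X -> R) by exact: measurable_fun_continuous.
have cdx : continuous (mdist x).
  by apply: lipschitz_continuous => a b; rewrite !(metric_sym x); exact: mdist_lipschitz.
have [M KM] : exists M, forall v, K v -> mdist x v <= M.
  have cdx' : {within K, continuous (mdist x)} by exact: continuous_subspaceT.
  have [w Kw wmax] := compact_EVT_max K0 cptK cdx'.
  by exists (mdist x w) => v Kv; apply: wmax; rewrite inE.
have mK_fin : (m (K : set (borel X)) < +oo)%E.
  apply: le_lt_trans (m_fin x (M + 1)); apply: le_measure; rewrite ?inE//.
    apply: measurable_open; rewrite ballEmdist.
    apply: (@open_comp _ _ (mdist x) [set r | r < M + 1]); last exact: open_lt.
    by move=> v _; exact: cdx.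
  by move=> v /KM; rewrite ballEmdist /=; lra.
have [d [Om [P [io [Om_res P_inv]]]]] := invariant_sampler cptG cact cptK K0 KG.
(* below level eps the two paths stay apart *)
pose eps := mdist x (act g x) / 2.
have eps0 : 0 < eps by rewrite divr_gt0// mdist_gt0; apply/eqP => /esym.
have epss : eps <= s.
  have := metric_triangle x y (act g x); rewrite (metric_sym y) gxy xy /eps; lra.
have apart r : 0 <= r < eps -> c1 r <> c2 r.
  move=> /andP[r0 re] E; have := metric_triangle x (c1 r) (act g x).
  have := lip1 0 r; have := lip2 r 0; rewrite c10 c20 -E sub0r subr0 normrN ger0_norm//.
  by move: re; rewrite /eps; lra.
clearbody eps.
(* the level of a random point of m between two given levels *)
have law (a b : R) : 0 < a -> a < b -> b < l -> exists q : measurableTypeR R -> R,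
    [/\ measurable_fun setT q, {homo q : u v / (u <= v)%R},
        forall u, a <= q u <= b, forall u, 0 <= q u <= l &
        forall N : set R, measurable N -> m (K `&` f @^-1` N) = 0%E ->
          unit_lebesgue (q @^-1` N) = 0%E].
  move=> a0 ab bl; have pos := slab_pos lev1 a0 ab bl.
  have pos' : (0 < m ((K : set (borel X)) `&` f @^-1` `[a, b]) < +oo)%E.
    rewrite pos /=; apply: le_lt_trans mK_fin; apply: le_measure; rewrite ?inE//.
    by apply: measurableI => //; rewrite -[X in measurable X]setTI; exact: mf.
  have [Q [Qab Q_ac]] := level_law mK mf pos'.
  have [q [mq hq qab Eq]] := quantile_exists Qab.
  exists q; split => // [u|N mN N0]; last by rewrite Eq//; exact: Q_ac.
  by have := qab u; move=> /andP[? ?]; apply/andP; split; lra.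
(* segments end where the two paths are apart, and start where they agree *)
have [|||ta [mta hta tab tal ta_ac]] := law (eps / 4) (eps / 2).
- by move: eps0; lra.
- by move: eps0; lra.
- by move: eps0 epss t0; rewrite /l; lra.
have [|||sg [msg hsg sgb sgl sg_ac]] := law (s + t / 4) (s + t / 2).
- by move: s0 t0; lra.
- by move: t0; lra.
- by move: t0; rewrite /l; lra.
have tas u : ta u < s by have := tab u; lra.
have ssg u : s < sg u by have := sgb u; move: t0; lra.
have [rho1 [rho1E ac1 law1 int1]] := segment_law cact iact sepX m_inv cptK K0 closedK
  KG mK_fin Om_res P_inv l_ge0 f_lip f_act fK orb1 lip1 cK1 fc1 msg mta sgl tal sg_ac ta_ac.
have [rho2 [rho2E ac2 law2 int2]] := segment_law cact iact sepX m_inv cptK K0 closedK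
  KG mK_fin Om_res P_inv l_ge0 f_lip f_act fK orb2 lip2 cK2 fc2 msg mta sgl tal sg_ac ta_ac.
set S1 := random_segment _ _ _ _ _ _ _ _ in rho1E int1.
set S2 := random_segment _ _ _ _ _ _ _ _ in rho2E int2.
have S10 p : (S1 p : geodesic X) itv0 = act (io p.1) (c1 (sg p.2)) by exact: segment0.
have S11 p : (S1 p : geodesic X) itv1 = act (io p.1) (c1 (ta p.2)) by exact: segment1.
have S20 p : (S2 p : geodesic X) itv0 = act (io p.1) (c2 (sg p.2)) by exact: segment0.
have S21 p : (S2 p : geodesic X) itv1 = act (io p.1) (c2 (ta p.2)) by exact: segment1.
(* each path is followed with probability one half *)
have [rho [rhoE rhoI]] := half_sum_exists rho1 rho2.
have half0 : (0 <= 2^-1 :> R) by rewrite invr_ge0.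
have halfE (a : \bar R) : (0 <= a -> 2^-1%:E * a + 2^-1%:E * a = a)%E.
  move=> a0; rewrite -ge0_muleDl ?lee_fin// -EFinD.
  by have -> : 2^-1 + 2^-1 = 1 :> R by [lra]; rewrite mul1e.
have [mu0 mu0E] := push_probability rho (measurable_geodesic_eval itv0).
have [mu1 mu1E] := push_probability rho (measurable_geodesic_eval itv1).
have int_le (h : borel (geodesic X) -> \bar R) (k : measurableTypeR R -> \bar R) :
    measurable_fun setT h -> (forall e, 0 <= h e)%E -> measurable_fun setT k ->
    (forall u, 0 <= k u)%E -> (forall p, h (S1 p) <= k p.2)%E ->
    (forall p, h (S2 p) <= k p.2)%E ->
    (\int[rho]_e h e <= \int[unit_lebesgue]_u k u)%E.
  move=> mh h0 mk k0 h1 h2; rewrite rhoI//.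
  rewrite -[leRHS]halfE; last by apply: integral_ge0 => u _; exact: k0.
  apply: leeD; apply: lee_wpmul2l; rewrite ?lee_fin//.
    exact: int1.
  exact: int2.
have fsm it (mu : probability (borel X) R) :
    mu = pushforward rho
      (fun c : borel (geodesic X) => (c : geodesic X) it : borel X)
      :> (set _ -> \bar R) ->
    (forall p, K ((S1 p : geodesic X) it)) -> (forall p, K ((S2 p : geodesic X) it)) ->
    finite_second_moment mu.
  move=> muE k1 k2; exists x; rewrite muE.
  have md : measurable_fun setT (fun v : borel X => ((mdist x (v : X)) ^+ 2)%:E).
    by apply/measurable_EFinP; apply: measurable_funX; exact: measurable_fun_continuous.
  have sq0 (r : R) : (0 <= (r ^+ 2)%:E)%E by rewrite lee_fin sqr_ge0.
  rewrite ge0_integral_pushforward//; last exact: measurable_geodesic_eval.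
  rewrite preimage_setT.
  apply: (@le_lt_trans _ _ (\int[unit_lebesgue]_u (M ^+ 2)%:E)%E); last first.
    rewrite integral_cst// [X in (_ * X)%E](_ : _ = 1%E) ?mule1 ?ltry//.
    exact: (@probability_setT _ _ _ unit_lebesgue).
  have bnd v : K v -> ((mdist x v ^+ 2)%:E <= (M ^+ 2)%:E)%E.
    move=> Kv; have vM := KM v Kv; rewrite lee_fin lerXn2r ?nnegrE ?mdist_ge0//.
    exact: le_trans (mdist_ge0 x v) vM.
  apply: int_le => //.
  - exact: (measurableT_comp md (measurable_geodesic_eval it)).
  - by move=> e; exact: sq0.
  - by move=> p; exact: bnd.
  - by move=> p; exact: bnd.
have KS10 p : K ((S1 p : geodesic X) itv0) by rewrite S10; apply/KG/cK1.
have KS11 p : K ((S1 p : geodesic X) itv1) by rewrite S11; apply/KG/cK1.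
have KS20 p : K ((S2 p : geodesic X) itv0) by rewrite S20; apply/KG/cK2.
have KS21 p : K ((S2 p : geodesic X) itv1) by rewrite S21; apply/KG/cK2.
have rho0E (A : set (borel X)) : rho [set e | A ((e : geodesic X) itv0)] = mu0 A.
  by rewrite mu0E.
have rho1E' (A : set (borel X)) : rho [set e | A ((e : geodesic X) itv1)] = mu1 A.
  by rewrite mu1E.
have dom0 : mu0 `<< m.
  apply/null_content_dominatesP => A mA A0; rewrite -rho0E rhoE.
  by have [-> _] := ac1 A mA A0; have [-> _] := ac2 A mA A0; rewrite mule0 adde0.
have dom1 : mu1 `<< m.
  apply/null_content_dominatesP => A mA A0; rewrite -rho1E' rhoE.
  by have [_ ->] := ac1 A mA A0; have [_ ->] := ac2 A mA A0; rewrite mule0 adde0.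
have opt : OptGeo mu0 mu1 rho.
  apply: (comonotone_plan_optimal sepX f_lip msg mta hsg hta) => //.
  - move=> r; rewrite -rho0E rhoE.
    by have [-> _] := law1 r; have [-> _] := law2 r; rewrite halfE.
  - move=> r; rewrite -rho1E' rhoE.
    by have [_ ->] := law1 r; have [_ ->] := law2 r; rewrite halfE.
  have sq0 (r : R) : (0 <= (r ^+ 2)%:E)%E by rewrite lee_fin sqr_ge0.
  have gap u : Num.max (sg u - ta u) 0 = `|sg u - ta u|.
    have h : 0 < sg u - ta u by rewrite subr_gt0; exact: lt_trans (tas u) (ssg u).
    by rewrite max_l ?gtr0_norm ?ltW.
  apply: int_le => //.
  - apply/measurable_EFinP; apply: measurable_funX.
    exact: (measurableT_comp (measurable_mdist sepX) (@measurable_endpoints R X)).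
  - apply/measurable_EFinP; apply: measurable_funX; apply: measurable_maxr => //.
    exact: measurable_funB.
  - by move=> p; rewrite S10 S11 iact gap (path_iso f_lip lip1 fc1).
  - by move=> p; rewrite S20 S21 iact gap (path_iso f_lip lip2 fc2).
have [Gamma nbG [N [mN N0 subN]]] := m_enb (fsm _ _ mu0E KS10 KS20) (fsm _ _ mu1E KS11 KS21)
  dom0 dom1 opt.
pose P2 : probability (Om * measurableTypeR R)%type R := (P \x unit_lebesgue)%E.
have null (Q : probability (borel (geodesic X)) R) S :
    Q = pushforward P2 S :> (set _ -> \bar R) -> Q N = 0%E -> P2 (S @^-1` N) = 0%E.
  by move=> -> .
have : rho1 N = 0%E /\ rho2 N = 0%E.
  have := N0; rewrite rhoE => /eqP; rewrite padde_eq0 ?mule_ge0 ?lee_fin//.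
  rewrite !mule_eq0 => /andP[].
  have -> : (2^-1%:E == 0 :> \bar R)%E = false by rewrite eqe invr_eq0 pnatr_eq0.
  by move=> /eqP -> /eqP ->.
move=> [/(null _ _ rho1E) n1 /(null _ _ rho2E) n2].
(* a choice of group element and levels that is good for both paths *)
have [p [p1 p2]] : exists p, ~ N (S1 p) /\ ~ N (S2 p).
  apply: contrapT => /forallNP H.
  have mS1 : measurable (S1 @^-1` N).
    rewrite -[X in measurable X]setTI.
    exact: (measurable_random_segment iact cptK K0 KG Om_res l_ge0
      f_lip lip1 cK1 fc1 msg mta).
  have mS2 : measurable (S2 @^-1` N).
    rewrite -[X in measurable X]setTI.
    exact: (measurable_random_segment iact cptK K0 KG Om_res l_ge0
      f_lip lip2 cK2 fc2 msg mta).
  have : (P2 setT <= 0)%E.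
    rewrite (_ : setT = S1 @^-1` N `|` S2 @^-1` N); last first.
      apply/seteqP; split => // q _; apply: contrapT => nq; apply: (H q).
      by split => Nq; apply: nq; [left|right].
    apply: le_trans (measureU2 _ _ _) _; [exact: mS1|exact: mS2|].
    rewrite -[leRHS]adde0; apply: leeD; [by rewrite [leLHS]n1|by rewrite [leLHS]n2].
  by rewrite probability_setT lee_fin ler10.
have G1 : Gamma (S1 p) by apply: contrapT => nG; apply: p1; exact: subN.
have G2 : Gamma (S2 p) by apply: contrapT => nG; apply: p2; exact: subN.
have h1 := tas p.2; have h2 := ssg p.2.
have E : S1 p = S2 p :> geodesic X.
  (* the fraction of the segment that lies above the level of y *)
  apply: nbG => //; exists ((sg p.2 - s) / (sg p.2 - ta p.2)).
    rewrite divr_gt0 ?subr_gt0 ?(lt_trans h1)//=.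
    by rewrite ltr_pdivrMr ?subr_gt0 ?(lt_trans h1)// mul1r; lra.
  move=> u; rewrite ler_pdivlMr ?subr_gt0 ?(lt_trans h1)// => us.
  rewrite /S1 /S2 /random_segment !segmentE//; congr act; apply: c12; lra.
have := apart (ta p.2); apply; first by have := tab p.2; have := tal p.2; lra.
have : (S1 p : geodesic X) itv1 = (S2 p : geodesic X) itv1 by rewrite E.
by rewrite S11 S21 => /(can_inj (actK cact (io p.1))).
Qed.

End TwoFeet.

(** * The slice theorem *)


Theorem theorem3 (R : realType) (X : completeMetricType R)
    (m : {measure set (borel X) -> \bar R})
    (G : topologicalGroupType) (act : G -> X -> X) :
  separable X -> geodesic_space X ->
  finite_on_balls m -> full_support m ->
  essentially_non_branching m ->
  compact_lie_group R G ->
  continuous_action act -> isometric_action act -> measure_preserving act m ->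
  [\/ isometric (orbit_space act) set_dist `[-1, 1] line_dist,
      isometric (orbit_space act) set_dist `[0, +oo[ line_dist,
      isometric (orbit_space act) set_dist [set: R] line_dist |
      isometric (orbit_space act) set_dist circle arc_dist] ->
  forall x0 : X, exists2 delta0 : R, 0 < delta0 &
    forall delta : R, 0 < delta < delta0 ->
      is_slice act x0
        ([set y | mdist x0 y = set_dist (act_orbit act x0) [set y]]
         `&` ball x0 delta).
Proof.
move=> sepX geoX m_fin m_supp m_enb [_ cptG] cact iact m_inv
  /locally_prolongable_models prolong x.
have orbit v : orbit_space act (act_orbit act v) by exists v.
have sdE := set_dist_orbits cptG cact iact.
have [d0 d0_gt0 Hd0] := prolong _ (orbit x); exists d0 => // d /andP[d_gt0 dd0].
apply: slice_of_unique_foot => // y g yd xy gxy.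
have [od0|od_neq0] := eqVneq (orbit_dist act x y) 0.
  by move: xy gxy; rewrite od0 => /mdist_positivity -> /mdist_positivity.
have od_gt0 : 0 < orbit_dist act x y by rewrite lt0r od_neq0 orbit_dist_ge0.
(* the orbit of w prolongs the segment from the orbit of x to that of y *)
have [|_ [[w _ <-]]] := Hd0 _ (orbit y); first by rewrite sdE od_gt0 (lt_trans yd).
rewrite !sdE => yw0 xw uniq inner.
have [h] := orbit_dist_attained cptG cact w y.
rewrite (orbit_dist_sym cptG cact iact) metric_sym; set z := act h w => yz.
have zE : act_orbit act w = act_orbit act z by rewrite act_orbit_act.
have odz v : orbit_dist act v w = orbit_dist act v z by rewrite -!sdE zE.
rewrite !odz in yw0 yz xw.
apply: contrapT; apply: (@two_feet_absurd _ _ _ act cptG cact iact sepX geoX m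
  m_fin m_supp m_enb m_inv x y z g _ _ od_gt0 yw0 xy gxy yz xw).
- rewrite -xw => v v' sv sv' vv'.
  have : act_orbit act v = act_orbit act v'.
    by apply: uniq; rewrite ?sdE ?odz//; exact: orbit.
  move=> E; have : act_orbit act v v' by rewrite E; exists 1%g => //; case: cact.
  by move=> [k _ kv]; exists k.
move=> v sv v0 vz; rewrite -xw in sv *.
have [|||r r0 Hr] := inner _ (orbit v); rewrite ?sdE ?odz//.
exists r => // v' vv'.
by have := Hr _ (orbit v'); rewrite !sdE !odz; apply.
Qed.
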